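(* For every $n\geq 1$ there is an integer $g(n)$, depending only on $n$, with the following property. Let $\Delta\subset GL_n(\mathbb{Z})$ be any subgroup, let $a,b$ be coprime integers and $N$ a fixed positive integer. For an integer $k$ put $\Delta(k)=\Delta\cap GL_n(k\mathbb{Z})$, and let $\Delta_{a,b}$ be the subgroup of $\Delta$ generated by the subgroups $\Delta((a+bx)^N)$, $x\in\mathbb{Z}$. Then $\Delta_{a,b}$ is normal in $\Delta$ and the exponent of the quotient group $\Delta/\Delta_{a,b}$ is at most $g(n)$ (in particular it does not depend on $a$, $b$, $N$ or $\Delta$).
   Context: $GL_n(k\mathbb{Z})$ denotes the principal congruence subgroup of level $k$ in $GL_n(\mathbb{Z})$, i.e. the kernel of the reduction map $GL_n(\mathbb{Z})\to GL_n(\mathbb{Z}/k\mathbb{Z})$ (matrices congruent to the identity modulo $k$). *)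

(* Defs.v *)
From HB Require Import structures.
From mathcomp Require Import all_boot all_order all_algebra.
From mathcomp Require Import boolp classical_sets.

Set Implicit Arguments.
Unset Strict Implicit.
Unset Printing Implicit Defensive.

Import GRing.Theory.
Local Open Scope ring_scope.
Local Open Scope classical_set_scope.

Section Subgroups.
Local Open Scope group_scope.
Variable G : groupType.
Implicit Types (D H A B C S : set G).

Definition subgroup H : Prop :=
  [/\ H 1, forall x y, H x -> H y -> H (x * y) & forall x, H x -> H x^-1].

Definition generated S : set G := smallest subgroup S.

Definition normal_subgroup H D : Prop :=
  [/\ subgroup H, H `<=` D & forall x y, D x -> H y -> H (y ^ x)].

Definition setmul A B : set G := [set x * y | x in A & y in B].

(* The elements of D / H are the cosets x H with x in D; when H is normal in  *)
(* D they multiply by setmul, with H as identity, so quotient_exp H C e is    *)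
(* the e-th power of C in D / H.                                              *)
Definition cosets D H : set (set G) := [set setmul [set x] H | x in D].

Definition quotient_exp H C (e : nat) : set G := iter e (setmul C) H.

Definition kills_quotient D H (e : nat) : Prop :=
  forall C, cosets D H C -> quotient_exp H C e = H.

(* Satisfied by no e when D / H has infinite exponent. *)
Definition quotient_exponent D H (e : nat) : Prop :=
  [/\ (0 < e)%N, kills_quotient D H e
    & forall d : nat, (0 < d)%N -> kills_quotient D H d -> (e <= d)%N].

End Subgroups.

Definition GLZ (n : nat) := {A : 'M[int]_n | A \in unitmx}.

HB.instance Definition _ n := SubChoice.on (GLZ n).

Section GLZgroup.
Variable n : nat.
Implicit Types A B C : GLZ n.

Fact GLZ_mul_subproof A B : val A *m val B \in unitmx.
Proof. by rewrite unitmx_mul (valP A) (valP B). Qed.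

Fact GLZ_inv_subproof A : invmx (val A) \in unitmx.
Proof. by rewrite unitmx_inv (valP A). Qed.

Definition GLZ_mul A B : GLZ n := Sub (val A *m val B) (GLZ_mul_subproof A B).
Definition GLZ_one : GLZ n := Sub 1%:M (unitmx1 int n).
Definition GLZ_inv A : GLZ n := Sub (invmx (val A)) (GLZ_inv_subproof A).

Fact GLZ_mulA : associative GLZ_mul.
Proof. by move=> A B C; apply: val_inj; rewrite /= mulmxA. Qed.

Fact GLZ_mul1m : left_id GLZ_one GLZ_mul.
Proof. by move=> A; apply: val_inj; rewrite /= mul1mx. Qed.

Fact GLZ_mulm1 : right_id GLZ_one GLZ_mul.
Proof. by move=> A; apply: val_inj; rewrite /= mulmx1. Qed.

Fact GLZ_mulVm : left_inverse GLZ_one GLZ_inv GLZ_mul.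
Proof. by move=> A; apply: val_inj; rewrite /= mulVmx ?(valP A). Qed.

Fact GLZ_mulmV : right_inverse GLZ_one GLZ_inv GLZ_mul.
Proof. by move=> A; apply: val_inj; rewrite /= mulmxV ?(valP A). Qed.

HB.instance Definition _ := isGroup.Build (GLZ n)
  GLZ_mulA GLZ_mul1m GLZ_mulm1 GLZ_mulVm GLZ_mulmV.

End GLZgroup.

(* Level k ranges over all of int: k and - k give the same subgroup, and      *)
(* level 0 gives the trivial one, as (m %% 0)%Z = m.                           *)
Definition congruence_subgroup n (k : int) : set (GLZ n) :=
  [set A : GLZ n | forall i j, (val A i j = (1%:M : 'M_n) i j %[mod k])%Z].

Definition level_subgroup n (D : set (GLZ n)) (k : int) : set (GLZ n) :=
  D `&` congruence_subgroup k.

Definition progression_subgroup n (D : set (GLZ n)) (a b : int) (N : nat) :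
    set (GLZ n) :=
  generated (\bigcup_(x : int) level_subgroup D ((a + b * x) ^+ N)).

(* Main.v *)
From mathcomp Require Import all_boot all_order all_fingroup all_algebra.
From mathcomp Require Import all_solvable all_field all_character.
From mathcomp Require Import boolp classical_sets reals sequences exp Rstruct.
From mathcomp Require Import complex lra zify ring.
Require Import Defs.

(* A power A^e lies in Delta_{a,b} as soon as A^e = 1 modulo (a + b x)^N, so  *)
(* it suffices to find, for each prime l, some m = a + b x such that the      *)
(* l-part of the order of A modulo m^N is bounded in terms of n, and trivial  *)
(* for large l. By the formula for the order of GL_n(F_p), this holds when m  *)
(* is a product of primes p such that p^(n!) <> 1 modulo a fixed power of l.  *)
(* The classes of these primes generate (Z/B)^*, where B is b times that      *)
(* power: otherwise there are characters chi and psi modulo B, with chi and   *)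
(* psi^2 nontrivial, such that (1 - chi(p)) (1 - psi(p)) = 0 for all primes p *)
(* prime to B. Say that f has density v if the sum of f(d) Lambda(d) / d over *)
(* d <= X is v ln X + O(1). By Mertens, 1 has density 1, and a nontrivial     *)
(* character has density 0 or -1 (allowing -1 avoids proving that L(1, chi)   *)
(* does not vanish). Hence chi psi and chi psi^* have density -1, and the     *)
(* densities in |1 + chi psi + chi psi^*|^2 >= 0 give 3 - 2 - 2 >= 0, a       *)
(* contradiction.                                                             *)

Set Implicit Arguments.
Unset Strict Implicit.
Unset Printing Implicit Defensive.

Import Order.TTheory GRing.Theory Num.Theory.
Local Open Scope ring_scope.

(** * Sums over divisors *)

Lemma prime_mul_ind (P : nat -> Prop) :
  P 1%N -> (forall p m, prime p -> (0 < m)%N -> P m -> P (p * m)%N) ->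
  forall n, (0 < n)%N -> P n.
Proof.
move=> P1 PM n; elim/ltn_ind: n => n IH n_gt0.
have [->//|n_neq1] := eqVneq n 1%N.
have n_gt1 : (1 < n)%N by rewrite ltn_neqAle eq_sym n_neq1.
have [p p_pr /dvdnP[m nE]] := pdivP n_gt1.
have m_gt0 : (0 < m)%N by move: n_gt0; rewrite nE muln_gt0 => /andP[].
rewrite nE mulnC; apply: PM => //; apply: IH => //.
by rewrite nE ltn_Pmulr // prime_gt1.
Qed.

Section DivisorSums.
Variable V : nmodType.
Implicit Types (F : nat -> V) (n m d X : nat).

Lemma sum_divisors_nat F n X : (0 < n <= X)%N ->
  \sum_(d <- divisors n) F d = \sum_(1 <= d < X.+1 | (d %| n)%N) F d.
Proof.
move=> /andP[n_gt0 le_nX]; rewrite -[RHS]big_filter; apply: perm_big.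
apply: uniq_perm; rewrite ?divisors_uniq ?filter_uniq ?iota_uniq // => d.
rewrite mem_filter mem_index_iota -dvdn_divisors // ltnS.
case d_n: (d %| n)%N => //=.
by rewrite (dvdn_gt0 n_gt0 d_n) (leq_trans (dvdn_leq n_gt0 d_n)).
Qed.

Lemma sum_divisors_mulp F p m : prime p -> (0 < m)%N ->
  \sum_(d <- divisors (p * m)) F d =
  \sum_(d <- divisors m | ~~ (p %| d)%N) F d
  + \sum_(d <- divisors m) F (p * d)%N.
Proof.
move=> p_pr m_gt0; have p_gt0 := prime_gt0 p_pr.
rewrite -[X in X + _]big_filter -[X in _ + X](big_map (muln p) predT F).
rewrite -big_cat.
have mulp_inj : injective (muln p).
  by move=> d e /eqP; rewrite eqn_pmul2l // => /eqP.
apply: perm_big; apply: uniq_perm => [||d]; first exact: divisors_uniq.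
  rewrite cat_uniq filter_uniq ?(map_inj_uniq mulp_inj) ?divisors_uniq //=.
  rewrite andbT.
  by apply/hasPn => _ /mapP[d _ ->]; rewrite mem_filter dvdn_mulr.
rewrite mem_cat mem_filter -!dvdn_divisors ?muln_gt0 ?p_gt0 //.
have [/dvdnP[e ->]|p_d] /= := boolP (p %| d)%N.
  by rewrite mulnC dvdn_pmul2l // (mem_map mulp_inj) -dvdn_divisors.
rewrite Gauss_dvdr; last by rewrite coprime_sym prime_coprime.
case: (d %| m)%N => //; apply/esym/mapP => -[e _ dE].
by rewrite dE dvdn_mulr in p_d.
Qed.

Lemma sum_multiples F d X : (0 < d)%N ->
  \sum_(1 <= n < X.+1 | (d %| n)%N) F n =
  \sum_(1 <= m < (X %/ d).+1) F (d * m)%N.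
Proof.
move=> d_gt0; elim: X => [|X IH]; first by rewrite div0n !big_geq.
rewrite big_mkcond big_nat_recr //= -big_mkcond IH divnS //.
case: ifP => [d_X|_]; last by rewrite addr0.
rewrite add1n [in RHS]big_nat_recr //=; congr (_ + F _).
by have := divnS X d_gt0; rewrite d_X add1n => <-; rewrite mulnC divnK.
Qed.

Lemma sum_nat_divisors (F : nat -> nat -> V) X :
  \sum_(1 <= n < X.+1) \sum_(d <- divisors n) F d n =
  \sum_(1 <= d < X.+1) \sum_(1 <= m < (X %/ d).+1) F d (d * m)%N.
Proof.
transitivity (\sum_(1 <= n < X.+1) \sum_(1 <= d < X.+1 | (d %| n)%N) F d n).
  by apply: eq_big_nat => n n_X; rewrite (sum_divisors_nat _ n_X).
rewrite (exchange_big_dep_nat predT) //=.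
by apply: eq_big_nat => d /andP[d_gt0 _]; rewrite -sum_multiples.
Qed.

Lemma exchange_sum_divisors (F : nat -> nat -> V) n : (0 < n)%N ->
  \sum_(d <- divisors n) \sum_(e <- divisors (n %/ d)) F d e =
  \sum_(e <- divisors n) \sum_(d <- divisors (n %/ e)) F d e.
Proof.
move=> n_gt0.
have sum_dvdM (H : nat -> nat -> V) :
    \sum_(d <- divisors n) \sum_(e <- divisors (n %/ d)) H d e =
    \sum_(1 <= d < n.+1) \sum_(1 <= e < n.+1 | (d * e %| n)%N) H d e.
  rewrite (@sum_divisors_nat _ _ n) ?n_gt0 //= big_mkcond.
  apply: eq_big_nat => d /andP[d_gt0 _].
  case: ifP => [d_n|/negP d_n]; last first.
    rewrite big_pred0 // => e.
    by apply/negP => /(dvdn_trans (dvdn_mulr _ (dvdnn d))).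
  have n_d : (0 < n %/ d <= n)%N by rewrite leq_div divn_gt0 // dvdn_leq.
  rewrite (sum_divisors_nat _ n_d).
  by apply: eq_bigl => e; rewrite dvdn_divRL // mulnC.
rewrite sum_dvdM (sum_dvdM (fun e d => F d e)) (exchange_big_dep_nat predT) //=.
by apply: eq_bigr => e _; apply: eq_bigl => d; rewrite mulnC.
Qed.

End DivisorSums.

Lemma sum_eq_mem (V : pzRingType) (T : eqType) (s : seq T) (x : T) : uniq s ->
  \sum_(y <- s) (y == x)%:R = (x \in s)%:R :> V.
Proof.
move=> uniq_s; case: (boolP (x \in s)) => x_s; last first.
  by rewrite big1_seq // => y /= y_s; case: eqP x_s => // <-; rewrite y_s.
by rewrite (bigD1_seq _ x_s uniq_s) /= eqxx big1 ?addr0 // => y /negPf ->.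
Qed.

(** * The Moebius function *)

Definition moebius (n : nat) : int :=
  if all (fun p => logn p n == 1%N) (primes n)
  then (-1) ^+ size (primes n) else 0.

Lemma normr_moebius n : `|moebius n| <= 1.
Proof.
by rewrite /moebius; case: ifP; rewrite ?normr0 // normrX normrN1 expr1n.
Qed.

Lemma moebius_mulp p m : prime p -> (0 < m)%N ->
  moebius (p * m) = if (p %| m)%N then 0 else - moebius m.
Proof.
move=> p_pr m_gt0; have p_gt0 := prime_gt0 p_pr.
have logn_mulp q : q \in primes m -> logn q (p * m) = ((q == p) + logn q m)%N.
  by rewrite mem_primes => /andP[q_pr _]; rewrite lognM // logn_prime.
case: ifP => p_m; rewrite /moebius.
  case: ifP => // /allP /(_ p).
  rewrite primesM // primes_prime // mem_head => /(_ isT).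
  have p_in_m : p \in primes m by rewrite mem_primes p_pr m_gt0.
  by rewrite logn_mulp // eqxx; move: p_in_m; rewrite -logn_gt0; lia.
have primes_pm : perm_eq (primes (p * m)) (p :: primes m).
  apply: uniq_perm; rewrite ?primes_uniq //= ?primes_uniq.
    by rewrite mem_primes p_m !andbF.
  by move=> q; rewrite primesM // primes_prime // !inE.
rewrite (perm_all _ primes_pm) (perm_size primes_pm) /=.
have -> : logn p (p * m) = 1%N.
  by rewrite lognM // logn_prime // eqxx logn_coprime // prime_coprime // p_m.
rewrite eqxx /= exprS mulN1r.
have -> : all (fun q => logn q (p * m) == 1%N) (primes m)
        = all (fun q => logn q m == 1%N) (primes m).
  apply: eq_in_all => q q_m; rewrite logn_mulp //.
  move: q_m; rewrite mem_primes.
  by case: (q =P p) => // ->; rewrite p_m !andbF.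
by case: ifP; rewrite // oppr0.
Qed.

Lemma sum_moebius n : (0 < n)%N ->
  \sum_(d <- divisors n) moebius d = (n == 1%N)%:R.
Proof.
elim/prime_mul_ind => [|p m p_pr m_gt0 _]; first by rewrite big_seq1.
have -> : (p * m == 1)%N = false by rewrite muln_eq1; case: eqP p_pr => // ->.
rewrite sum_divisors_mulp // big_mkcond -big_split big1_seq //= => d.
rewrite -dvdn_divisors // => d_m; rewrite moebius_mulp ?(dvdn_gt0 m_gt0) //.
by case: (p %| d)%N; rewrite ?addr0 ?subrr.
Qed.

Lemma moebius_inversion (V : zmodType) (f g : nat -> V) :
  (forall n, (0 < n)%N -> \sum_(d <- divisors n) f d = g n) ->
  forall n, (0 < n)%N -> f n = \sum_(d <- divisors n) g (n %/ d)%N *~ moebius d.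
Proof.
move=> sum_f n n_gt0.
transitivity
  (\sum_(d <- divisors n) \sum_(e <- divisors (n %/ d)) f e *~ moebius d).
  rewrite exchange_sum_divisors //.
  rewrite (bigD1_seq _ (divisors_id n_gt0) (divisors_uniq n)) /=.
  rewrite divnn n_gt0 big_seq1 big1_seq ?addr0 // => d /andP[d_neqn].
  rewrite -dvdn_divisors // => d_n; have d_gt0 := dvdn_gt0 n_gt0 d_n.
  rewrite -mulrz_sumr sum_moebius; last by rewrite divn_gt0 // dvdn_leq.
  by rewrite -(eqn_pmul2r d_gt0) divnK // mul1n eq_sym (negPf d_neqn).
apply: eq_big_seq => d; rewrite -dvdn_divisors // => d_n.
have d_gt0 := dvdn_gt0 n_gt0 d_n.
by rewrite -sum_f ?mulrz_suml // divn_gt0 // dvdn_leq.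
Qed.

(** * The von Mangoldt function and the estimates of Chebyshev and Mertens *)

Section Logarithm.
Variable R : realType.
Implicit Types m n : nat.

Definition lnn n : R := ln n%:R.

Lemma lnn1 : lnn 1 = 0. Proof. exact: ln1. Qed.

Lemma lnnM m n : (0 < m)%N -> (0 < n)%N -> lnn (m * n) = lnn m + lnn n.
Proof. by move=> m_gt0 n_gt0; rewrite /lnn natrM lnM // posrE ltr0n. Qed.

Lemma ler_lnn m n : (0 < m)%N -> (m <= n)%N -> lnn m <= lnn n.
Proof.
move=> m_gt0 le_mn; rewrite ler_ln ?ler_nat // posrE ltr0n //.
exact: leq_trans le_mn.
Qed.

Lemma lnn_ge0 n : 0 <= lnn n.
Proof.
by case: n => [|n]; [rewrite /lnn ln0 | apply: ln_ge0; rewrite ler1n].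
Qed.

Lemma lnn_unbounded (C : R) : exists2 n, (0 < n)%N & C < lnn n.
Proof.
pose n := Num.bound (expR C).
have lt_expC : expR C < n%:R by apply: archi_boundP; rewrite expR_ge0.
have n_gt0 : (0 < n)%N.
  by rewrite -(ltr0n R); apply: lt_trans lt_expC; apply: expR_gt0.
by exists n => //; rewrite -[C](@expRK R) ltr_ln // posrE ?expR_gt0 ?ltr0n.
Qed.

Lemma lnnS_le n : (0 < n)%N -> n%:R * (lnn n.+1 - lnn n) <= 1.
Proof.
move=> n_gt0; have nR_gt0 : 0 < n%:R :> R by rewrite ltr0n.
rewrite /lnn -ln_div ?posrE ?ltr0n //.
have -> : n.+1%:R / n%:R = 1 + n%:R^-1 :> R.
  by rewrite -natr1 mulrDl divff ?mul1r // gt_eqF.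
rewrite mulrC -ler_pdivlMr // mul1r; apply: le_ln1Dx.
by apply: (@lt_trans _ _ 0); rewrite ?ltrN10 // invr_gt0.
Qed.

Lemma lnn_fact X : lnn X`! = \sum_(1 <= n < X.+1) lnn n.
Proof.
elim: X => [|X IH]; first by rewrite big_geq // fact0 lnn1.
by rewrite factS mulnC lnnM ?fact_gt0 // big_nat_recr //= IH.
Qed.

Lemma lnn_fact_ge X : X%:R * lnn X - X%:R <= lnn X`!.
Proof.
elim: X => [|X IH]; first by rewrite mul0r subr0 lnn_ge0.
rewrite factS lnnM ?fact_gt0 //.
case: X IH => [|X] IH; first by rewrite fact0 lnn1; lra.
have := @lnnS_le X.+1 isT; rewrite -(natr1 X.+1); move: IH; nra.
Qed.

Lemma lnn_fact_le X : lnn X`! <= X%:R * lnn X.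
Proof.
rewrite lnn_fact; apply: (@le_trans _ _ (\sum_(1 <= n < X.+1) lnn X)).
  by apply: ler_sum_nat => n /andP[n_gt0 le_nX]; apply: ler_lnn.
by rewrite sumr_const_nat subn1 mulr_natl.
Qed.

Lemma lnn_bin_le n m : (m <= n)%N -> lnn 'C(n, m) <= n%:R * lnn 2.
Proof.
move=> le_mn; have -> : n%:R * lnn 2 = lnn (2 ^ n).
  by rewrite /lnn natrX lnXn ?mulr_natl // ltr0n.
apply: ler_lnn; first by rewrite bin_gt0.
rewrite -[2%N]/(1 + 1)%N expnDn (bigD1 (Ordinal (le_mn : m < n.+1)%N)) //=.
by rewrite !exp1n !muln1 leq_addr.
Qed.

End Logarithm.

Section VonMangoldt.
Variable R : realType.
Implicit Types n m d p k X : nat.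
Local Notation lnn := (lnn R).

Definition vonMangoldt n : R := if primes n is [:: p] then lnn p else 0.

Local Notation Lambda := vonMangoldt.

Lemma vonMangoldt_ge0 n : 0 <= Lambda n.
Proof.
by rewrite /vonMangoldt; case: primes => [|p [|]] //; apply: lnn_ge0.
Qed.

Lemma vonMangoldt_div_ge0 n : 0 <= Lambda n / n%:R.
Proof. by rewrite divr_ge0 ?vonMangoldt_ge0. Qed.

Lemma vonMangoldtP n :
  Lambda n != 0 -> exists p k, [/\ prime p, (0 < k)%N & n = (p ^ k)%N].
Proof.
rewrite /vonMangoldt; case primes_n: (primes n) => [|p [|]];
  rewrite ?eqxx // => _.
have p_n : p \in primes n by rewrite primes_n mem_head.
have [p_pr n_gt0 _] : [/\ prime p, (0 < n)%N & (p %| n)%N].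
  by apply/and3P; rewrite -mem_primes.
exists p, (logn p n); split; rewrite ?logn_gt0 //.
by rewrite {1}(prod_prime_decomp n_gt0) prime_decompE primes_n big_seq1.
Qed.

Lemma vonMangoldt1 : Lambda 1 = 0. Proof. by []. Qed.

Lemma vonMangoldt_mulp p m : prime p -> (0 < m)%N ->
  Lambda (p * m) = if (p %| m)%N then Lambda m else (m == 1%N)%:R * lnn p.
Proof.
move=> p_pr m_gt0; have p_gt0 := prime_gt0 p_pr.
have primesE q : (q \in primes (p * m)) = (q == p) || (q \in primes m).
  by rewrite primesM // primes_prime // inE.
case: ifP => p_m; rewrite /vonMangoldt.
  suff -> : primes (p * m) = primes m by [].
  apply/eq_primes => q; rewrite primesE; case: eqP => // ->.
  by rewrite mem_primes p_pr m_gt0 p_m.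
have [->|m_neq1] := eqVneq m 1%N; first by rewrite muln1 primes_prime // mul1r.
have m_gt1 : (1 < m)%N by rewrite ltn_neqAle eq_sym m_neq1.
have pdiv_pm : pdiv m \in primes (p * m).
  by rewrite primesE mem_primes pdiv_prime // m_gt0 pdiv_dvd orbT.
have p_pm : p \in primes (p * m) by rewrite primesE eqxx.
rewrite mul0r; case: primes pdiv_pm p_pm => [|q [|]] //.
by rewrite !inE => /eqP <- /eqP p_pdiv; rewrite p_pdiv pdiv_dvd in p_m.
Qed.

Lemma sum_vonMangoldt n : (0 < n)%N -> \sum_(d <- divisors n) Lambda d = lnn n.
Proof.
elim/prime_mul_ind => [|p m p_pr m_gt0 IH]; first by rewrite big_seq1 lnn1.
rewrite sum_divisors_mulp // lnnM ?(prime_gt0 p_pr) // -IH addrC.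
rewrite [X in _ = _ + X](bigID (fun d => p %| d)%N) /= addrA; congr (_ + _).
have -> : lnn p = \sum_(d <- divisors m) (d == 1%N)%:R * lnn p.
  by rewrite -mulr_suml sum_eq_mem ?divisors_uniq // divisor1 mul1r.
rewrite [X in _ = _ + X]big_mkcond -big_split; apply: eq_big_seq => d /=.
rewrite -dvdn_divisors // => d_m; rewrite vonMangoldt_mulp ?(dvdn_gt0 m_gt0) //.
case: ifP => [p_d|]; last by rewrite addr0.
case: eqP p_d => [->|]; rewrite ?mul0r ?add0r // dvdn1 => /eqP p_eq1.
by rewrite p_eq1 in p_pr.
Qed.

Lemma vonMangoldt_moebius (x : R) n : (0 < n)%N ->
  \sum_(d <- divisors n) (moebius d)%:~R * (x - lnn d) =
  (n == 1%N)%:R * x + Lambda n.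
Proof.
move=> n_gt0; rewrite (moebius_inversion sum_vonMangoldt n_gt0).
have -> : (n == 1%N)%:R * x = (n == 1%N)%:R * (x - lnn n).
  by case: eqP => [->|]; rewrite ?mul0r // lnn1 subr0.
rewrite -[(n == 1%N)%:R](rmorph_nat (intr : int -> R)) -(sum_moebius n_gt0).
rewrite rmorph_sum mulr_suml -big_split; apply: eq_big_seq => d /=.
rewrite -dvdn_divisors // => d_n; have d_gt0 := dvdn_gt0 n_gt0 d_n.
have -> : lnn n = lnn (n %/ d) + lnn d.
  by rewrite -lnnM ?divnK // divn_gt0 // dvdn_leq.
by rewrite -[_ *~ _]mulrzl; ring.
Qed.

Definition chebyshev X : R := \sum_(1 <= d < X.+1) Lambda d.

Lemma lnn_fact_vonMangoldt X Y : (X <= Y)%N ->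
  lnn X`! = \sum_(1 <= d < Y.+1) Lambda d * (X %/ d)%:R.
Proof.
move=> le_XY; rewrite (big_cat_nat (n := X.+1)) //= [X in _ + X]big_nat.
rewrite [X in _ + X]big1; last first.
  by move=> d /andP[lt_Xd _]; rewrite divn_small // mulr0.
rewrite addr0 lnn_fact.
transitivity (\sum_(1 <= n < X.+1) \sum_(d <- divisors n) Lambda d).
  by apply: eq_big_nat => n /andP[n_gt0 _]; rewrite sum_vonMangoldt.
rewrite (sum_nat_divisors (fun d _ => Lambda d)).
by apply: eq_bigr => d _; rewrite sumr_const_nat subn1 mulr_natr.
Qed.

(* The coefficient floor((m+n)/d) - floor(m/d) - floor(n/d) of Lambda(d) in   *)
(* ln 'C(m + n, m) is nonnegative, and positive when d lies in ]m, m + n].    *)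
Lemma chebyshevB_le m n : (n <= m)%N ->
  chebyshev (m + n) - chebyshev m <= lnn 'C(m + n, m).
Proof.
move=> le_nm; set X := (m + n)%N.
have [le_mX le_nX] : (m <= X)%N /\ (n <= X)%N by rewrite /X; lia.
have -> : lnn 'C(X, m) = lnn X`! - (lnn m`! + lnn n`!).
  rewrite -(bin_fact le_mX) lnnM ?bin_gt0 ?muln_gt0 ?fact_gt0 //.
  by rewrite lnnM ?fact_gt0 // /X addKn addrK.
rewrite !(@lnn_fact_vonMangoldt _ X) // -big_split -sumrB /chebyshev.
rewrite (big_cat_nat (n := m.+1)) //= addrAC subrr add0r.
rewrite [leRHS](big_cat_nat (n := m.+1)) //=.
have divD_ge d : (0 <= (X %/ d)%:R - (m %/ d)%:R - (n %/ d)%:R :> R).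
  rewrite subr_ge0 lerBrDl -natrD ler_nat /X.
  by case: (posnP d) => [->|d_gt0]; rewrite ?divn0 // divnD // leq_addr.
rewrite -[leLHS]add0r lerD //.
  apply: sumr_ge0 => d _; rewrite -mulrDr -mulrBr opprD addrA.
  by rewrite mulr_ge0 ?vonMangoldt_ge0.
apply: ler_sum_nat => d /andP[lt_md le_dX].
rewrite (@divn_small m) // (@divn_small n) ?(leq_ltn_trans le_nm) //.
rewrite mulr0 addr0 subr0.
rewrite ler_peMr ?vonMangoldt_ge0 // ler1n divn_gt0 //.
exact: leq_ltn_trans lt_md.
Qed.

Lemma chebyshev_le X : chebyshev X <= 4 * X%:R.
Proof.
elim/ltn_ind: X => X IH.
have ln2_le1 : lnn 2 <= 1.
  by have := lnnS_le R (ltn0Sn 0); rewrite lnn1 subr0 mul1r.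
case: (leqP X 1) => [|X_gt1].
  case: X {IH} => [|[|//]] _; first by rewrite /chebyshev big_geq // mulr0.
  by rewrite /chebyshev big_nat1 vonMangoldt1; lra.
set m := uphalf X; set n := X./2.
have [mE le_mX] : (m.*2 <= X.+1)%N /\ (m < X)%N.
  by rewrite /m uphalf_half; have := odd_double_half X; lia.
have le_nm : (n <= m)%N by rewrite /m uphalf_half leq_addl.
have XE : X = (m + n)%N.
  by rewrite /m /n uphalf_half; have := odd_double_half X; lia.
have := chebyshevB_le le_nm; rewrite -XE.
have := lnn_bin_le R (ltnW le_mX); have := IH _ le_mX.
move: mE; rewrite -(ler_nat R) -muln2 natrM -natr1.
have X_ge2 : 2 <= X%:R :> R by rewrite ler_nat.
have : X%:R * lnn 2 <= X%:R by rewrite ler_piMr.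
lra.
Qed.

Definition mangoldt_sum (f : nat -> R) X : R :=
  \sum_(1 <= d < X.+1) f d * (Lambda d / d%:R).

Lemma mertens_le X : (0 < X)%N -> mangoldt_sum (fun=> 1) X <= lnn X + 4.
Proof.
move=> X_gt0; have X_gt0R : 0 < X%:R :> R by rewrite ltr0n.
rewrite -(ler_pM2l X_gt0R).
have : X%:R * mangoldt_sum (fun=> 1) X <= lnn X`! + chebyshev X.
  rewrite (lnn_fact_vonMangoldt (leqnn X)) -big_split mulr_sumr /=.
  apply: ler_sum_nat => d /andP[d_gt0 _]; rewrite mul1r.
  rewrite mulrCA -{3}[Lambda d]mulr1 -mulrDr ler_wpM2l ?vonMangoldt_ge0 //.
  rewrite ler_pdivrMr ?ltr0n // natr1 -natrM ler_nat ltnW //.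
  by rewrite mulnC {1}(divn_eq X d) mulnS mulnC addnC ltn_add2r ltn_mod.
have := chebyshev_le X; have := lnn_fact_le R X; nra.
Qed.

Lemma mertens_ge X : (0 < X)%N -> lnn X - 1 <= mangoldt_sum (fun=> 1) X.
Proof.
move=> X_gt0; have X_gt0R : 0 < X%:R :> R by rewrite ltr0n.
rewrite -(ler_pM2l X_gt0R).
have : lnn X`! <= X%:R * mangoldt_sum (fun=> 1) X.
  rewrite (lnn_fact_vonMangoldt (leqnn X)) mulr_sumr /=.
  apply: ler_sum_nat => d /andP[d_gt0 _]; rewrite mul1r.
  rewrite mulrCA ler_wpM2l ?vonMangoldt_ge0 //.
  by rewrite ler_pdivlMr ?ltr0n // -natrM ler_nat leq_trunc_div.
have := lnn_fact_ge R X; nra.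
Qed.

Lemma mangoldt_sum_multiples_le p X : prime p ->
  mangoldt_sum (fun d => (p %| d)%:R) X <= 2 * lnn p.
Proof.
move=> p_pr; have p_gt0 := prime_gt0 p_pr.
have p_gt0R : 0 < p%:R :> R by rewrite ltr0n.
elim/ltn_ind: X => X IH; case: (posnP X) => [->|X_gt0].
  by rewrite /mangoldt_sum big_geq // mulr_ge0 ?lnn_ge0.
have -> : mangoldt_sum (fun d => (p %| d)%:R) X =
    p%:R^-1 * \sum_(1 <= m < (X %/ p).+1) Lambda (p * m) / m%:R.
  transitivity (\sum_(1 <= d < X.+1 | (p %| d)%N) Lambda d / d%:R).
    rewrite [RHS]big_mkcond; apply: eq_bigr => d _.
    by case: (p %| d)%N; rewrite ?mul1r ?mul0r.
  rewrite sum_multiples // mulr_sumr; apply: eq_bigr => m _.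
  by rewrite natrM invfM; ring.
rewrite mulrC ler_pdivrMr //.
have : \sum_(1 <= m < (X %/ p).+1) Lambda (p * m) / m%:R <=
    lnn p + mangoldt_sum (fun d => (p %| d)%:R) (X %/ p).
  apply: (@le_trans _ _ (\sum_(1 <= m < (X %/ p).+1)
      ((m == 1%N)%:R * lnn p + (p %| m)%:R * (Lambda m / m%:R)))).
    apply: ler_sum_nat => m /andP[m_gt0 _]; rewrite vonMangoldt_mulp //.
    case: (boolP (p %| m)%N) => p_m.
      by rewrite mul1r lerDr mulr_ge0 ?lnn_ge0.
    rewrite mul0r addr0; case: eqP => [->|_]; first by rewrite invr1 mulr1.
    by rewrite !mul0r.
  rewrite big_split lerD2r /= -mulr_suml ler_piMl ?lnn_ge0 //.
  case: (X %/ p)%N => [|x]; first by rewrite big_geq.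
  rewrite big_ltn // eqxx big_nat big1 ?addr0 // => m /andP[m_gt1 _].
  by rewrite gtn_eqF.
have := IH (X %/ p)%N; rewrite ltn_Pdiv ?prime_gt1 // => /(_ isT).
have := lnn_ge0 R p; have : 2 <= p%:R :> R by rewrite ler_nat prime_gt1.
nra.
Qed.

End VonMangoldt.

Section MangoldtDensity.
Variable R : realType.
Implicit Types (f g : nat -> R) (v w : R) (p k n B X : nat).
Local Notation Lambda := (vonMangoldt R).
Local Notation lnn := (lnn R).

Definition mangoldt_density f v : Prop :=
  exists C, forall X, (0 < X)%N -> `|mangoldt_sum f X - v * lnn X| <= C.

Lemma eq_mangoldt_density f g v :
  (forall p k, prime p -> (0 < k)%N -> f (p ^ k)%N = g (p ^ k)%N) ->
  mangoldt_density f v -> mangoldt_density g v.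
Proof.
move=> eq_fg [C f_v]; exists C => X X_gt0.
suff <- : mangoldt_sum f X = mangoldt_sum g X by apply: f_v.
apply: eq_bigr => d _.
have [->|/vonMangoldtP[p [k [p_pr k_gt0 ->]]]] := eqVneq (Lambda d) 0.
  by rewrite mul0r !mulr0.
by rewrite eq_fg.
Qed.

Lemma mangoldt_density_linear a f g v w :
  mangoldt_density f v -> mangoldt_density g w ->
  mangoldt_density (fun n => a * f n + g n) (a * v + w).
Proof.
move=> [C f_v] [D g_w]; exists (`|a| * C + D) => X X_gt0.
have -> : mangoldt_sum (fun n => a * f n + g n) X - (a * v + w) * lnn X =
    a * (mangoldt_sum f X - v * lnn X) + (mangoldt_sum g X - w * lnn X).
  have -> : mangoldt_sum (fun n => a * f n + g n) X =
      a * mangoldt_sum f X + mangoldt_sum g X.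
    rewrite mulr_sumr -big_split; apply: eq_bigr => d _.
    by rewrite /= mulrDl -mulrA.
  ring.
apply: le_trans (ler_normD _ _) _; rewrite normrM.
by rewrite lerD ?ler_wpM2l ?f_v ?g_w.
Qed.

Lemma mangoldt_density_ge0 f v :
  (forall n, 0 <= f n) -> mangoldt_density f v -> 0 <= v.
Proof.
move=> f_ge0 [C f_v]; rewrite leNgt; apply/negP => v_lt0.
have [X X_gt0] := lnn_unbounded (C / - v).
rewrite ltr_pdivrMr ?oppr_gt0 // => lt_C.
have sum_ge0 : 0 <= mangoldt_sum f X.
  by apply: sumr_ge0 => d _; rewrite mulr_ge0 ?vonMangoldt_div_ge0.
by have := f_v X X_gt0; rewrite ler_norml => /andP[_]; lra.
Qed.

Lemma mangoldt_density_unique f v w :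
  mangoldt_density f v -> mangoldt_density f w -> v = w.
Proof.
have density_le x y :
    mangoldt_density f x -> mangoldt_density f y -> x <= y.
  move=> f_x f_y; rewrite -subr_ge0 addrC -mulN1r.
  apply: mangoldt_density_ge0 (mangoldt_density_linear (-1) f_x f_y) => n.
  by rewrite mulN1r addNr.
by move=> f_v f_w; apply/eqP; rewrite eq_le !density_le.
Qed.

Lemma mangoldt_density1 : mangoldt_density (fun=> 1) 1.
Proof.
exists 4 => X X_gt0; have := mertens_le R X_gt0; have := mertens_ge R X_gt0.
rewrite ler_norml; lra.
Qed.

Lemma mangoldt_density_primes (s : seq nat) : all prime s ->
  mangoldt_density (fun n => \sum_(p <- s) (p %| n)%:R) 0.
Proof.
elim: s => [_|p s IH /= /andP[p_pr /IH dens_s]].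
  exists 0 => X _; rewrite mul0r subr0 /mangoldt_sum big1 ?normr0 // => d _.
  by rewrite big_nil mul0r.
have dens_p : mangoldt_density (fun n => (p %| n)%:R) 0.
  exists (2 * lnn p) => X _; rewrite mul0r subr0 ger0_norm.
    exact: mangoldt_sum_multiples_le.
  by apply: sumr_ge0 => d _; rewrite mulr_ge0 ?vonMangoldt_div_ge0.
have := mangoldt_density_linear 1 dens_p dens_s; rewrite mul1r addr0.
by apply: eq_mangoldt_density => q k _ _; rewrite big_cons mul1r.
Qed.

Lemma mangoldt_density_coprime B : (0 < B)%N ->
  mangoldt_density (fun n => (coprime n B)%:R) 1.
Proof.
move=> B_gt0; have primes_pr : all prime (primes B).
  by apply/allP => p; rewrite mem_primes => /andP[].
have := mangoldt_density_linear (-1) (mangoldt_density_primes primes_pr)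
  mangoldt_density1.
rewrite mulr0 add0r; apply: eq_mangoldt_density => q k q_pr k_gt0.
have -> : \sum_(p <- primes B) (p %| q ^ k)%:R = (q %| B)%:R :> R.
  transitivity (\sum_(p <- primes B) (p == q)%:R : R).
    apply: eq_big_seq => p; rewrite mem_primes => /and3P[p_pr _ _].
    by rewrite Euclid_dvdX // k_gt0 andbT dvdn_prime2.
  have -> : (q %| B)%N = (q \in primes B) by rewrite mem_primes q_pr B_gt0.
  by rewrite sum_eq_mem ?primes_uniq.
rewrite coprime_pexpl // prime_coprime //.
by case: (q %| B)%N; rewrite /= ?mulr0 ?mulr1 ?addNr ?add0r.
Qed.

End MangoldtDensity.

(** * Sums of completely multiplicative functions *)

Section ComplexNorm.
Variable R : rcfType.
Implicit Types z w : Rcomplex R.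

Lemma Rcomplex_normrM z w : `|z * w : Rcomplex R| = `|z| * `|w| :> R.
Proof. exact: Normc.normcM. Qed.

Lemma Rcomplex_normr1 : `|1 : Rcomplex R| = 1 :> R.
Proof. exact: Normc.normc1. Qed.

Lemma Rcomplex_normrX z n : `|z ^+ n : Rcomplex R| = `|z| ^+ n :> R.
Proof.
elim: n => [|n IH]; first exact: Rcomplex_normr1.
by rewrite !exprS Rcomplex_normrM IH.
Qed.

Lemma Rcomplex_normrZ (a : R) z : `|a *: z| = `|a| * `|z| :> R.
Proof.
have -> : a *: z = a%:C%C * z by case: z => x y; rewrite /GRing.scale /=; simpc.
rewrite Rcomplex_normrM; congr (_ * _); rewrite -sqrtr_sqr.
by congr Num.sqrt; rewrite expr0n addr0.
Qed.

Lemma Rcomplex_ler_Re z : `|complex.Re z| <= `|z|.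
Proof.
case: z => x y /=; rewrite -sqrtr_sqr.
by apply: ler_wsqrtr; rewrite lerDl sqr_ge0.
Qed.

End ComplexNorm.

Lemma bounded_eventually (R : realDomainType) (u : nat -> R) (j : nat) (C : R) :
  (forall X, (j <= X)%N -> u X <= C) -> exists D, forall X, u X <= D.
Proof.
elim: j C => [|j IH] C le_uC; first by exists C => X; apply: le_uC.
apply: (IH (Num.max C (u j))) => X; rewrite leq_eqVlt le_max.
by case/predU1P=> [<-|/le_uC ->]; rewrite ?lexx ?orbT.
Qed.

Lemma summation_by_parts (K : pzRingType) (V : lmodType K) (f : nat -> K)
    (a : nat -> V) j k : (j <= k)%N ->
  \sum_(j <= n < k) f n *: a n =
  f k *: (\sum_(j <= n < k) a n) +
  \sum_(j <= n < k) (f n - f n.+1) *: \sum_(j <= m < n.+1) a m.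
Proof.
elim: k => [|k IH].
  by rewrite leqn0 => /eqP ->; rewrite !big_geq // scaler0 addr0.
rewrite leq_eqVlt => /predU1P[->|]; first by rewrite !big_geq // scaler0 addr0.
rewrite ltnS => le_jk; rewrite !big_nat_recr ?leqW //= IH //.
rewrite scalerBl [in RHS]addrCA [f k.+1 *: _ + _]addrC subrK scalerDr.
by rewrite addrAC [in RHS]addrC.
Qed.

Section CharacterSums.
Variable R : realType.
Implicit Types (f : nat -> R) (n m d k j X Y : nat).
Local Notation Lambda := (vonMangoldt R).
Local Notation lnn := (lnn R).

Variables (chi : nat -> Rcomplex R) (B : R).
Hypothesis chi1 : chi 1 = 1.
Hypothesis chiM : forall m n, chi (m * n) = chi m * chi n.
Hypothesis norm_chi_le1 : forall n, `|chi n| <= 1.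
Hypothesis norm_sum_chi_le : forall k, `|\sum_(0 <= n < k) chi n| <= B.

Let B_ge0 : 0 <= B.
Proof. exact: le_trans (norm_sum_chi_le 0). Qed.

Lemma norm_sum_chi_antitone_le f j k : (j <= k)%N ->
  (forall n, (j <= n)%N -> 0 <= f n) ->
  (forall n, (j <= n)%N -> f n.+1 <= f n) ->
  `|\sum_(j <= n < k) f n *: chi n| <= 2 * B * f j.
Proof.
move=> le_jk f_ge0 f_antitone.
have norm_block i : (j <= i)%N -> `|\sum_(j <= n < i) chi n| <= 2 * B.
  move=> le_ji; have -> : \sum_(j <= n < i) chi n =
      \sum_(0 <= n < i) chi n - \sum_(0 <= n < j) chi n.
    by rewrite [in RHS](big_cat_nat (n := j)) //= addrAC subrr add0r.
  apply: le_trans (ler_normB _ _) _.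
  by have := norm_sum_chi_le i; have := norm_sum_chi_le j; lra.
rewrite summation_by_parts //; apply: le_trans (ler_normD _ _) _.
apply: (@le_trans _ _ (2 * B * f k + \sum_(j <= n < k) 2 * B * (f n - f n.+1))).
  apply: lerD.
    have fk_ge0 := f_ge0 k le_jk.
    by rewrite Rcomplex_normrZ ger0_norm // mulrC ler_wpM2r ?norm_block.
  apply: le_trans (ler_norm_sum _ _ _) _.
  apply: ler_sum_nat => n /andP[le_jn _].
  have df_ge0 : 0 <= f n - f n.+1 by rewrite subr_ge0 f_antitone.
  by rewrite Rcomplex_normrZ ger0_norm // mulrC ler_wpM2r ?norm_block // ltnW.
have -> : \sum_(j <= n < k) 2 * B * (f n - f n.+1) = 2 * B * (f j - f k).
  rewrite -mulr_sumr -[f j - f k]opprB -telescope_sumr // -sumrN.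
  by congr (_ * _); apply: eq_bigr => n _; rewrite opprB.
by rewrite -mulrDr addrC subrK.
Qed.

Lemma norm_sum_chi_antitone_bounded f j : (0 < j)%N ->
  (forall n, (j <= n)%N -> 0 <= f n) ->
  (forall n, (j <= n)%N -> f n.+1 <= f n) ->
  exists C, forall X, `|\sum_(1 <= n < X.+1) f n *: chi n| <= C.
Proof.
move=> j_gt0 f_ge0 f_antitone.
pose C := `|\sum_(1 <= n < j) f n *: chi n| + 2 * B * f j.
apply: (@bounded_eventually _ _ j C) => X le_jX.
rewrite (big_cat_nat (n := j)) //=; last exact: leqW.
apply: le_trans (ler_normD _ _) _; rewrite lerD2l.
by apply: norm_sum_chi_antitone_le; rewrite // leqW.
Qed.

Definition Lseries_sum k : Rcomplex R := \sum_(1 <= m < k.+1) m%:R^-1 *: chi m.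

Lemma norm_Lseries_sumB_le j k : (j <= k)%N ->
  `|Lseries_sum k - Lseries_sum j| <= 2 * B / j.+1%:R.
Proof.
move=> le_jk; rewrite /Lseries_sum [X in X - _](big_cat_nat (n := j.+1)) //=.
rewrite addrAC subrr add0r.
apply: (norm_sum_chi_antitone_le (f := fun m => m%:R^-1)) => // n lt_jn.
  by rewrite invr_ge0.
by rewrite lef_pV2 ?posrE ?ltr0n ?ler_nat // (leq_trans _ lt_jn).
Qed.

Lemma sum_chi_lnn_bounded :
  exists C, forall X, `|\sum_(1 <= n < X.+1) (lnn n / n%:R) *: chi n| <= C.
Proof.
have [j j_gt0 lnj_gt1] := lnn_unbounded (1 : R).
apply: (norm_sum_chi_antitone_bounded j_gt0) => n le_jn.
  by rewrite divr_ge0 ?lnn_ge0 ?ler0n.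
have n_gt0 : (0 < n)%N by apply: leq_trans le_jn.
rewrite ler_pdivrMr ?ltr0n // mulrAC ler_pdivlMr ?ltr0n //.
have := lnnS_le R n_gt0; have := ler_lnn R j_gt0 le_jn; rewrite -natr1; nra.
Qed.

Lemma sum_chi_divisors f X :
  \sum_(1 <= n < X.+1) ((\sum_(d <- divisors n) f d) / n%:R) *: chi n =
  \sum_(1 <= d < X.+1) (f d / d%:R) *: (chi d * Lseries_sum (X %/ d)).
Proof.
transitivity
  (\sum_(1 <= n < X.+1) \sum_(d <- divisors n) (f d / n%:R) *: chi n).
  by apply: eq_bigr => n _; rewrite mulr_suml scaler_suml.
rewrite (sum_nat_divisors (fun d n => (f d / n%:R) *: chi n)).
apply: eq_bigr => d _; rewrite /Lseries_sum mulr_sumr scaler_sumr.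
apply: eq_bigr => m _.
rewrite [chi d * (_ *: _)]mulrC -scalerAl scalerA [chi m * _]mulrC -chiM.
by rewrite natrM invfM mulrA.
Qed.

Lemma norm_sum_chi_div_le f (c : nat -> Rcomplex R) K X : (0 < X)%N ->
  (forall Y, (Y <= X)%N -> `|c Y| <= K / Y.+1%:R) ->
  `|\sum_(1 <= d < X.+1) (f d / d%:R) *: (chi d * c (X %/ d)%N)| <=
  K * (\sum_(1 <= d < X.+1) `|f d|) / X%:R.
Proof.
move=> X_gt0 norm_c; have X_gt0R : 0 < X%:R :> R by rewrite ltr0n.
have K_ge0 : 0 <= K by have := norm_c 0%N isT; rewrite divr1; apply: le_trans.
apply: le_trans (ler_norm_sum _ _ _) _; rewrite mulr_sumr mulr_suml.
apply: ler_sum_nat => d /andP[d_gt0 _].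
have d_gt0R : 0 < d%:R :> R by rewrite ltr0n.
have inv_floor : (X %/ d).+1%:R^-1 <= d%:R / X%:R :> R.
  rewrite ler_pdivlMr // mulrC ler_pdivrMr ?ltr0n //.
  by rewrite -natrM ler_nat mulnC ltnW // ltn_ceil.
have le_c : `|c (X %/ d)%N| <= K * (d%:R / X%:R).
  exact: le_trans (norm_c _ (leq_div _ _)) (ler_wpM2l K_ge0 inv_floor).
rewrite Rcomplex_normrZ Rcomplex_normrM normf_div normr_nat.
have -> : K * `|f d| / X%:R = `|f d| / d%:R * (K * (d%:R / X%:R)).
  by field; rewrite !gt_eqF.
rewrite ler_wpM2l ?divr_ge0 //; apply: le_trans le_c.
by rewrite ler_piMl.
Qed.

Definition Lseries_mangoldt_sum X : Rcomplex R :=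
  \sum_(1 <= d < X.+1) (Lambda d / d%:R) *: chi d.

Lemma norm_Lseries_sumM_bounded :
  exists C, forall X, (0 < X)%N ->
    `|Lseries_sum X * Lseries_mangoldt_sum X : Rcomplex R| <= C.
Proof.
have [C norm_lnn_le] := sum_chi_lnn_bounded; exists (C + 8 * B) => X X_gt0.
have -> : Lseries_sum X * Lseries_mangoldt_sum X =
    \sum_(1 <= n < X.+1) (lnn n / n%:R) *: chi n -
    \sum_(1 <= d < X.+1)
      (Lambda d / d%:R) *: (chi d * (Lseries_sum (X %/ d) - Lseries_sum X)).
  under eq_big_nat => n /andP[n_gt0 _] do rewrite -(sum_vonMangoldt R n_gt0).
  rewrite sum_chi_divisors -sumrB mulr_sumr; apply: eq_bigr => d _.
  by rewrite -scalerBr -mulrBr opprB addrC subrK mulrC -scalerAl.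
apply: le_trans (ler_normB _ _) _; rewrite lerD //.
have norm_tail Y : (Y <= X)%N ->
    `|Lseries_sum Y - Lseries_sum X| <= 2 * B / Y.+1%:R.
  by rewrite distrC; apply: norm_Lseries_sumB_le.
apply: le_trans (norm_sum_chi_div_le Lambda X_gt0 norm_tail) _.
rewrite ler_pdivrMr ?ltr0n //.
under eq_bigr do rewrite ger0_norm ?vonMangoldt_ge0 //.
have := chebyshev_le R X; have := B_ge0; rewrite /chebyshev; nra.
Qed.

Lemma lnn_add_Lseries_mangoldt_sum X : (0 < X)%N ->
  lnn X *: 1 + Lseries_mangoldt_sum X =
  \sum_(1 <= d < X.+1)
    ((moebius d)%:~R * (lnn X - lnn d) / d%:R) *:
    (chi d * Lseries_sum (X %/ d)).
Proof.
move=> X_gt0; rewrite -sum_chi_divisors.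
under eq_big_nat => n /andP[n_gt0 _].
  by rewrite (vonMangoldt_moebius (lnn X) n_gt0) mulrDl scalerDl; over.
rewrite big_split /=; congr (_ + _); rewrite big_ltn // eqxx mul1r divr1 chi1.
rewrite big_nat big1 ?addr0 // => n /andP[n_gt1 _].
by rewrite gtn_eqF // !mul0r scale0r.
Qed.

Lemma norm_lnn_add_Lseries_mangoldt_sum_le :
  (forall k, `|Lseries_sum k| <= 2 * B / k.+1%:R) ->
  forall X, (0 < X)%N -> `|lnn X *: 1 + Lseries_mangoldt_sum X| <= 2 * B.
Proof.
move=> norm_L X X_gt0; rewrite lnn_add_Lseries_mangoldt_sum //.
apply: le_trans (norm_sum_chi_div_le _ X_gt0 (fun Y _ => norm_L Y)) _.
rewrite ler_pdivrMr ?ltr0n // ler_wpM2l ?mulr_ge0 //.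
apply: (@le_trans _ _ (\sum_(1 <= d < X.+1) (lnn X - lnn d))).
  apply: ler_sum_nat => d /andP[d_gt0 le_dX]; rewrite normrM.
  have dln_ge0 : 0 <= lnn X - lnn d by rewrite subr_ge0 ler_lnn.
  rewrite (ger0_norm dln_ge0) ler_piMl // -intr_norm -[1]/(1%:~R) ler_int.
  exact: normr_moebius.
rewrite sumrB sumr_const_nat subn1 -lnn_fact /= -mulr_natl.
by have := lnn_fact_ge R X; lra.
Qed.

Lemma norm_Lseries_mangoldt_sum_bounded j :
  2 * B / j.+1%:R < `|Lseries_sum j| ->
  exists C, forall X, (0 < X)%N -> `|Lseries_mangoldt_sum X| <= C.
Proof.
move=> norm_Lj; have [C norm_LM] := norm_Lseries_sumM_bounded.
pose delta := `|Lseries_sum j| - 2 * B / j.+1%:R.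
have delta_gt0 : 0 < delta by rewrite subr_gt0.
suff [D norm_le] : exists D, forall X, `|Lseries_mangoldt_sum X| <= D.
  by exists D => X _; apply: norm_le.
apply: (@bounded_eventually _ _ j.+1 (C / delta)) => X lt_jX.
have X_gt0 : (0 < X)%N by apply: leq_ltn_trans lt_jX.
rewrite ler_pdivlMr //; apply: le_trans (norm_LM X X_gt0).
rewrite Rcomplex_normrM mulrC ler_wpM2r // lerBlDr -lerBlDl.
apply: le_trans (lerB_dist _ _) _.
by rewrite distrC norm_Lseries_sumB_le // ltnW.
Qed.

(* The density is -1 exactly when the series of the chi m / m vanishes. *)
Lemma mangoldt_density_character :
  exists v : bool, mangoldt_density (fun n => complex.Re (chi n)) (- v%:R).
Proof.
have Re_sum X : mangoldt_sum (fun n => complex.Re (chi n)) X =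
    complex.Re (Lseries_mangoldt_sum X).
  rewrite [RHS]linear_sum; apply: eq_bigr => d _.
  by rewrite linearZ /= mulrC.
case: (pselect (forall k, `|Lseries_sum k| <= 2 * B / k.+1%:R)) => [norm_L|].
  exists true, (2 * B) => X X_gt0; rewrite Re_sum mulN1r opprK.
  apply: le_trans (norm_lnn_add_Lseries_mangoldt_sum_le norm_L X_gt0).
  apply: le_trans (Rcomplex_ler_Re _).
  by rewrite [X in _ <= `|X|]linearD linearZ /= mulr1 addrC.
move=> /existsNP[j /negP]; rewrite -ltNge.
move=> /norm_Lseries_mangoldt_sum_bounded[C norm_le].
exists false, C => X X_gt0; rewrite Re_sum oppr0 mul0r subr0.
exact: le_trans (Rcomplex_ler_Re _) (norm_le X X_gt0).
Qed.

End CharacterSums.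

(** * Dirichlet characters *)

Section DirichletCharacters.
Variable R : realType.
Local Open Scope complex_scope.
Implicit Types (n m d k p B : nat) (chi psi : nat -> Rcomplex R).

Definition dirichlet_character B chi : Prop :=
  [/\ forall m n, chi (m * n)%N = chi m * chi n,
      forall n, chi (n %% B)%N = chi n,
      forall n, coprime n B -> `|chi n| = 1
    & forall n, ~~ coprime n B -> chi n = 0].

Definition nontrivial_character B chi : Prop :=
  exists2 u, coprime u B & chi u != 1.

Lemma dirichlet_character1 B chi : dirichlet_character B chi -> chi 1%N = 1.
Proof.
move=> [chiM _ norm_chi _].
have chi1_neq0 : chi 1%N != 0 by rewrite -normr_gt0 norm_chi ?coprime1n.
by apply: (mulfI chi1_neq0); rewrite -chiM muln1 mulr1.
Qed.

Lemma dirichlet_characterX B chi n k :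
  dirichlet_character B chi -> chi (n ^ k)%N = chi n ^+ k.
Proof.
move=> char_chi; elim: k => [|k IH]; first exact: dirichlet_character1 char_chi.
by case: char_chi => chiM _ _ _; rewrite expnS chiM IH exprS.
Qed.

Lemma dirichlet_character_norm_le1 B chi n :
  dirichlet_character B chi -> `|chi n| <= 1.
Proof.
move=> [_ _ norm_chi chi0].
by case: (boolP (coprime n B)) => [/norm_chi ->|/chi0 ->]; rewrite ?normr0.
Qed.

Lemma dirichlet_characterM B chi psi :
  dirichlet_character B chi -> dirichlet_character B psi ->
  dirichlet_character B (fun n => chi n * psi n).
Proof.
move=> [chiM chi_mod norm_chi chi0] [psiM psi_mod norm_psi psi0].
split=> [m n|n|n n_B|n n_B].
- by rewrite chiM psiM mulrACA.
- by rewrite chi_mod psi_mod.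
- by rewrite Rcomplex_normrM norm_chi // norm_psi // mulr1.
- by rewrite chi0 // mul0r.
Qed.

Lemma dirichlet_character_conj B chi :
  dirichlet_character B chi -> dirichlet_character B (fun n => (chi n)^*).
Proof.
move=> [chiM chi_mod norm_chi chi0]; split=> [m n|n|n n_B|n n_B].
- by rewrite chiM; apply: rmorphM.
- by rewrite chi_mod.
- by rewrite -[RHS](norm_chi n n_B); have [] := normcJ (chi n).
- by rewrite chi0 //; apply: rmorph0.
Qed.

Lemma conjc_eq1 (z : Rcomplex R) : (z^* == 1) = (z == 1).
Proof. by case: z => x y; rewrite !eq_complex /= oppr_eq0. Qed.

Lemma eqn_modMl u m n B : coprime u B ->
  (u * m == u * n %[mod B])%N = (m == n %[mod B])%N.
Proof.
move=> u_B; wlog le_mn : m n / (m <= n)%N.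
  move=> wlog_le; case/orP: (leq_total m n) => /wlog_le // eq_nm.
  by rewrite eq_sym eq_nm eq_sym.
rewrite eq_sym eqn_mod_dvd ?leq_mul2l ?le_mn ?orbT // -mulnBr.
rewrite Gauss_dvdr; last by rewrite coprime_sym.
by rewrite -eqn_mod_dvd // eq_sym.
Qed.

Lemma sum_dirichlet_character_period B chi : (0 < B)%N ->
  dirichlet_character B chi -> nontrivial_character B chi ->
  \sum_(0 <= n < B) chi n = 0.
Proof.
case: B => // B _ [chiM chi_mod _ _] [u u_B chi_u].
rewrite big_mkord; set s := \sum_(i < _) _.
pose mulu (i : 'I_B.+1) : 'I_B.+1 := inord (u * i %% B.+1).
have muluE i : mulu i = (u * i %% B.+1)%N :> nat by rewrite inordK // ltn_mod.
have mulu_inj : injective mulu.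
  move=> i j /(congr1 val) /=; rewrite !muluE => /eqP; rewrite eqn_modMl //.
  by rewrite !modn_small // => /eqP /val_inj.
have s_inv : s = chi u * s.
  rewrite {1}/s (reindex_inj mulu_inj) /= mulr_sumr; apply: eq_bigr => i _.
  by rewrite muluE chi_mod chiM.
apply/eqP; move/eqP: s_inv; rewrite -subr_eq0 -{1}[s]mul1r -mulrBl.
by rewrite mulf_eq0 subr_eq0 eq_sym (negPf chi_u).
Qed.

Lemma norm_sum_dirichlet_character_le B chi k : (0 < B)%N ->
  dirichlet_character B chi -> nontrivial_character B chi ->
  `|\sum_(0 <= n < k) chi n| <= B%:R.
Proof.
move=> B_gt0 char_chi nt_chi; elim/ltn_ind: k => k IH.
case: (ltnP k B) => [lt_kB|le_Bk].
  apply: le_trans (ler_norm_sum _ _ _) _.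
  apply: (@le_trans _ _ (\sum_(0 <= n < k) 1)).
    by apply: ler_sum => n _; apply: dirichlet_character_norm_le1 char_chi.
  by rewrite sumr_const_nat subn0 ler_nat ltnW.
rewrite (big_cat_nat (n := B)) //= sum_dirichlet_character_period // add0r.
rewrite -{1}[B]add0n big_addn.
have [_ chi_mod _ _] := char_chi.
have chiD n : chi (n + B)%N = chi n by rewrite -chi_mod modnDr chi_mod.
under eq_bigr do rewrite chiD.
by apply: IH; rewrite ltn_subrL B_gt0 (leq_trans B_gt0).
Qed.

Lemma mangoldt_density_dirichlet B chi : (0 < B)%N ->
  dirichlet_character B chi -> nontrivial_character B chi ->
  exists v : bool, mangoldt_density (fun n => complex.Re (chi n)) (- v%:R).
Proof.
move=> B_gt0 char_chi nt_chi; apply: (@mangoldt_density_character R chi B%:R).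
- exact: dirichlet_character1 char_chi.
- by case: char_chi.
- by move=> n; apply: dirichlet_character_norm_le1 char_chi.
- by move=> k; apply: norm_sum_dirichlet_character_le.
Qed.

(* As (1 - chi) (1 - psi) vanishes at the prime powers prime to B, chi psi    *)
(* has the density of chi + psi - 1, which is at most -1.                     *)
Lemma mangoldt_density_covering B chi psi : (0 < B)%N ->
  dirichlet_character B chi -> dirichlet_character B psi ->
  nontrivial_character B chi -> nontrivial_character B psi ->
  (forall p, prime p -> ~~ (p %| B)%N -> chi p = 1 \/ psi p = 1) ->
  mangoldt_density (fun n => complex.Re (chi n * psi n)) (-1).
Proof.
move=> B_gt0 char_chi char_psi nt_chi nt_psi cover.
have char_mul := dirichlet_characterM char_chi char_psi.
have dens1 := mangoldt_density_coprime R B_gt0.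
have [v dens_chi] := mangoldt_density_dirichlet B_gt0 char_chi nt_chi.
have [w dens_psi] := mangoldt_density_dirichlet B_gt0 char_psi nt_psi.
have dens_add := mangoldt_density_linear 1 dens_chi dens_psi.
have dens_mul : mangoldt_density (fun n => complex.Re (chi n * psi n))
    (- 1 - v%:R - w%:R).
  have -> : - 1 - v%:R - w%:R = -1 * 1 + (1 * - v%:R + - w%:R) :> R by ring.
  apply: eq_mangoldt_density (mangoldt_density_linear (-1) dens1 dens_add).
  move=> p k p_pr k_gt0; rewrite coprime_pexpl // prime_coprime //.
  case: (boolP (p %| B)%N) => p_B /=.
    have pk_B : ~~ coprime (p ^ k) B.
      by rewrite coprime_pexpl // prime_coprime // negbK.
    case: char_chi char_psi => _ _ _ -> // [_ _ _ ->] //.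
    by rewrite mul0r /= !mulr0 !addr0.
  rewrite (dirichlet_characterX _ _ char_chi).
  rewrite (dirichlet_characterX _ _ char_psi).
  by case: (cover p p_pr p_B) => ->; rewrite expr1n ?mul1r ?mulr1 /=; ring.
have [nt_mul|triv_mul] :=
  pselect (nontrivial_character B (fun n => chi n * psi n)).
  have [u dens_u] := mangoldt_density_dirichlet B_gt0 char_mul nt_mul.
  have := mangoldt_density_unique dens_u dens_mul.
  case: u dens_u => // _ /eqP; rewrite oppr0 eq_sym -!opprD oppr_eq0.
  by rewrite paddr_eq0 ?addr_ge0 // paddr_eq0 // oner_eq0.
have dens_triv : mangoldt_density (fun n => complex.Re (chi n * psi n)) 1.
  apply: eq_mangoldt_density dens1 => p k _ _.
  case: (boolP (coprime (p ^ k) B)) => pk_B; last by case: char_mul => _ _ _ ->.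
  suff -> : chi (p ^ k)%N * psi (p ^ k)%N = 1 by [].
  by apply/eqP/negPn/negP => neq1; apply: triv_mul; exists (p ^ k)%N.
have := mangoldt_density_unique dens_triv dens_mul.
have : 0 <= v%:R :> R by []; have : 0 <= w%:R :> R by []; lra.
Qed.

(* Twice the right-hand side is |1 + z w + z w^*|^2. *)
Lemma three_characters_ge0 (z w : Rcomplex R) : `|z| = 1 -> `|w| = 1 ->
  0 <= 3 / 2 + complex.Re (z * w) + complex.Re (z * w^*) + complex.Re (w * w).
Proof.
have sqr_norm1 x y : `|x +i* y : Rcomplex R| = 1 -> x ^+ 2 + y ^+ 2 = 1.
  move=> norm1; rewrite -[LHS]sqr_sqrtr ?addr_ge0 ?sqr_ge0 //.
  by rewrite [Num.sqrt _]norm1 expr1n.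
case: z w => a b [c d] /sqr_norm1 norm_z /sqr_norm1 norm_w /=.
set s := (X in _ <= X).
suff -> : s = 2^-1 * ((1 + (a * c - b * d) + (a * c + b * d)) ^+ 2
            + ((a * d + b * c) + (b * c - a * d)) ^+ 2).
  by rewrite mulr_ge0 ?invr_ge0 ?addr_ge0 ?sqr_ge0.
transitivity (2^-1 * (1 + 2 * (a * c - b * d) + 2 * (a * c + b * d)
  + 2 * (a ^+ 2 + b ^+ 2) * (c ^+ 2 + d ^+ 2)
  + 2 * (a ^+ 2 + b ^+ 2) * (c ^+ 2 - d ^+ 2))); last by field.
by rewrite norm_z norm_w /s; field.
Qed.

Theorem prime_outside_kernels B chi psi : (0 < B)%N ->
  dirichlet_character B chi -> dirichlet_character B psi ->
  nontrivial_character B chi ->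
  nontrivial_character B (fun n => psi n * psi n) ->
  exists p, [/\ prime p, ~~ (p %| B)%N, chi p != 1 & psi p != 1].
Proof.
move=> B_gt0 char_chi char_psi nt_chi nt_psi2; apply: contrapT => no_prime.
have cover p : prime p -> ~~ (p %| B)%N -> chi p = 1 \/ psi p = 1.
  move=> p_pr p_B; case: (eqVneq (chi p) 1) => [|chi_p]; [by left | right].
  by apply: contrapT => /eqP psi_p; apply: no_prime; exists p.
have [nt_psi nt_psiJ] : nontrivial_character B psi /\
    nontrivial_character B (fun n => (psi n)^*).
  case: nt_psi2 => u u_B psi2_u.
  have psi_u : psi u != 1 by apply: contraNneq psi2_u => ->; rewrite mulr1.
  by split; exists u; rewrite ?conjc_eq1.
have coverJ p : prime p -> ~~ (p %| B)%N -> chi p = 1 \/ (psi p)^* = 1.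
  move=> p_pr p_B; case: (cover p p_pr p_B) => [|/eqP]; first by left.
  by rewrite -conjc_eq1 => /eqP; right.
have dens1 := mangoldt_density_coprime R B_gt0.
have dens_mul :=
  mangoldt_density_covering B_gt0 char_chi char_psi nt_chi nt_psi cover.
have dens_mulJ := mangoldt_density_covering B_gt0 char_chi
  (dirichlet_character_conj char_psi) nt_chi nt_psiJ coverJ.
have char_sqr := dirichlet_characterM char_psi char_psi.
have [v dens_sqr] := mangoldt_density_dirichlet B_gt0 char_sqr nt_psi2.
have dens_sum := mangoldt_density_linear (3 / 2) dens1
  (mangoldt_density_linear 1 dens_mul
    (mangoldt_density_linear 1 dens_mulJ dens_sqr)).
suff : 0 <= 3 / 2 * 1 + (1 * -1 + (1 * -1 + - v%:R)) :> R.
  by have : 0 <= v%:R :> R by []; lra.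
apply: mangoldt_density_ge0 dens_sum => n.
case: (boolP (coprime n B)) => n_B; last first.
  case: char_chi char_psi => _ _ _ -> // [_ _ _ ->] //.
  by rewrite !mul0r /= !mulr0 !addr0.
rewrite !mul1r !addrA mulr1.
case: char_chi char_psi => _ _ norm_chi _ [_ _ norm_psi _].
exact: three_characters_ge0 (norm_chi n n_B) (norm_psi n n_B).
Qed.

End DirichletCharacters.

(** * Residues of products of primes *)

Lemma prim_root_exists (C : closedFieldType) n :
  n%:R != 0 :> C -> exists z : C, n.-primitive_root z.
Proof.
move=> n_neq0; have n_gt0 : (0 < n)%N by case: (n) n_neq0; rewrite ?eqxx.
have [r Xn_sub_1] := closed_field_poly_normal ('X^n - 1 : {poly C}).
rewrite (monicP _) ?monicXnsubC // scale1r in Xn_sub_1.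
have unity_r : all n.-unity_root r.
  by apply/allP => z; rewrite -root_prod_XsubC -Xn_sub_1.
have size_r : (n < (size r).+1)%N.
  by rewrite -(size_prod_XsubC r id) -Xn_sub_1 size_XnsubC.
have [|z] := hasP (has_prim_root n_gt0 unity_r _ size_r); last by exists z.
by rewrite -separable_prod_XsubC -Xn_sub_1 separable_Xn_sub_1.
Qed.

Section AbelianCharacters.
Variables (gT : finGroupType) (G H : {group gT}) (g : gT).
Hypotheses (abG : abelian G) (sHG : H \subset G) (gG : g \in G)
  (gH : g \notin H).

Lemma abelian_character_algC : exists f : gT -> algC,
  [/\ {in G &, {morph f : x y / (x * y)%g >-> x * y}},
      {in G, forall x, f x ^+ #|G| = 1}, {in H, forall x, f x = 1} & f g != 1].
Proof.
have nHG : G \subset 'N(H)%g.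
  by rewrite cents_norm //; apply: fintype.subset_trans abG (centS sHG).
have gHbar_neq1 : coset H g != 1%g.
  by apply: contra gH => /eqP; apply: coset_idr; apply: (fintype.subsetP nHG).
have [i ker_i] : exists i : Iirr (G / H)%G, coset H g \notin cfker 'chi_i.
  apply/existsP; apply: contraR gHbar_neq1.
  rewrite negb_exists => /forallP ker_all.
  suff : coset H g \in [1 coset_of H]%g by rewrite inE.
  rewrite -(TI_cfker_irr (G / H)%G); apply/bigcapP => i _.
  by have := ker_all i; rewrite negbK.
have lin_i : 'chi_i \is a linear_char.
  by move/char_abelianP: (quotient_abelian H abG); apply.
have GH x : x \in G -> coset H x \in (G / H)%g by apply: mem_quotient.
exists (fun x => 'chi_i (coset H x)); split=> [x y xG yG|x xG|x xH|].
- by rewrite morphM ?(fintype.subsetP nHG) // (lin_charM lin_i) ?GH.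
- rewrite -(lin_charX lin_i) ?GH // -morphX ?(fintype.subsetP nHG) //.
  by rewrite expg_cardG // morph1 (lin_char1 lin_i).
- by rewrite coset_id // (lin_char1 lin_i).
- by move: ker_i; rewrite cfkerEirr inE (lin_char1 lin_i).
Qed.

(* The values of a character over algC are powers of a primitive root of      *)
(* unity, which can be replaced by one of C.                                  *)
Lemma abelian_character (C : closedFieldType) : #|G|%:R != 0 :> C ->
  exists f : gT -> C,
  [/\ {in G &, {morph f : x y / (x * y)%g >-> x * y}},
      {in G, forall x, f x ^+ #|G| = 1}, {in H, forall x, f x = 1} & f g != 1].
Proof.
move=> G_neq0; have [f [fM fX fH fg]] := abelian_character_algC.
have [w prim_w] := prim_root_exists G_neq0.
have [z prim_z] := C_prim_root_exists (cardG_gt0 G).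
have f_expr x : exists k, x \in G -> f x = z ^+ k.
  case: (boolP (x \in G)) => xG; last by exists 0%N.
  by have [k fxE] := prim_rootP prim_z (fX x xG); exists k.
have [k fE] := choice f_expr.
have wk_eq1 x : x \in G -> (w ^+ k x == 1) = (f x == 1).
  move=> xG; rewrite (fE x xG) -(expr0 w) -(expr0 z).
  by rewrite (eq_prim_root_expr prim_w) (eq_prim_root_expr prim_z).
exists (fun x => w ^+ k x); split=> [x y xG yG|x xG|x xH|].
- rewrite -exprD; apply/eqP.
  rewrite (eq_prim_root_expr prim_w) -(eq_prim_root_expr prim_z) exprD.
  by rewrite -!fE ?groupM // fM.
- by rewrite exprAC (prim_expr_order prim_w) expr1n.
- by apply/eqP; rewrite wk_eq1 ?(fintype.subsetP sHG) // fH.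
- by rewrite wk_eq1.
Qed.

End AbelianCharacters.

Lemma coprime_prod_seq (s : seq nat) B :
  all (coprime^~ B) s -> coprime (\prod_(m <- s) m)%N B.
Proof.
move/allP=> s_B; rewrite big_seq; elim/big_ind: _ => [|m n m_B n_B|m /s_B //].
  exact: coprime1n.
by rewrite coprimeMl m_B.
Qed.

Section Residues.
Variable B : nat.
Hypothesis B_gt1 : (1 < B)%N.
Implicit Types (m n p q e w a : nat) (H K : {group {unit 'Z_B}}).

Definition residue_unit n : {unit 'Z_B} :=
  insubd (1%g : {unit 'Z_B}) (n%:R : 'Z_B).

Lemma val_residue_unit n : coprime n B -> val (residue_unit n) = n%:R.
Proof. by move=> n_B; rewrite val_insubd unitZpE // coprime_sym n_B. Qed.

Lemma residue_unit1 : residue_unit 1 = 1%g.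
Proof. by apply: val_inj; rewrite val_residue_unit ?coprime1n. Qed.

Lemma residue_unitM m n : coprime m B -> coprime n B ->
  residue_unit (m * n) = (residue_unit m * residue_unit n)%g.
Proof.
move=> m_B n_B; apply: val_inj.
by rewrite FinRing.val_unitM !val_residue_unit ?coprimeMl ?m_B // natrM.
Qed.

Lemma residue_unitP (u : {unit 'Z_B}) :
  exists2 n, coprime n B & u = residue_unit n.
Proof.
have u_B : coprime (val u : 'Z_B) B.
  by rewrite coprime_sym -unitZpE // natr_Zp; exact: valP.
exists (val u : 'Z_B) => //.
by apply: val_inj; rewrite val_residue_unit // natr_Zp.
Qed.

Lemma residue_unit_eqP m n : coprime m B -> coprime n B ->
  residue_unit m = residue_unit n <-> m = n %[mod B].
Proof.
move=> m_B n_B; split=> [/(congr1 val)|eq_mn].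
  by rewrite !val_residue_unit // => /(congr1 val) /=; rewrite !val_Zp_nat.
apply/val_inj; rewrite !val_residue_unit //.
by apply/val_inj; rewrite /= !val_Zp_nat.
Qed.

Lemma units_Zp_ring_abelian : abelian [set: {unit 'Z_B}].
Proof.
by apply/centsP => x _ y _; apply: val_inj; rewrite !FinRing.val_unitM mulrC.
Qed.

Lemma dirichlet_character_exists (R : realType) H g :
  coprime g B -> residue_unit g \notin H ->
  exists2 chi : nat -> Rcomplex R, dirichlet_character B chi &
    (forall n, coprime n B -> residue_unit n \in H -> chi n = 1) /\ chi g != 1.
Proof.
move=> g_B gH.
have card_neq0 : #|[group of [set: {unit 'Z_B}]]|%:R != 0 :> R[i].
  by rewrite pnatr_eq0 -lt0n cardG_gt0.
have [f [fM fX fH fg]] := abelian_character units_Zp_ring_abelian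
  (finset.subsetT H) (finset.in_setT _) gH card_neq0.
have norm_f u : `|f u : Rcomplex R| = 1.
  have := congr1 (fun z : Rcomplex R => `|z|) (fX u (finset.in_setT u)).
  rewrite Rcomplex_normrX Rcomplex_normr1 => /eqP.
  by rewrite pexpr_eq1 ?cardG_gt0 // => /eqP.
exists (fun n => if coprime n B then f (residue_unit n) else 0).
  split=> [m n|n|n ->//|n /negPf -> //].
  - rewrite coprimeMl; case: (boolP (coprime m B)) => m_B; rewrite ?mul0r //=.
    case: (boolP (coprime n B)) => n_B; rewrite ?mulr0 //=.
    by rewrite residue_unitM // fM ?inE.
  - rewrite coprime_modl; case: ifP => // n_B; congr f.
    by apply/residue_unit_eqP; rewrite ?coprime_modl ?modn_mod.
by split=> [n n_B nH|]; rewrite ?g_B // n_B fH.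
Qed.

Lemma prime_outside_subgroups H K a w :
  coprime a B -> residue_unit a \notin H ->
  coprime w B -> residue_unit (w * w) \notin K ->
  exists p, [/\ prime p, ~~ (p %| B)%N,
    residue_unit p \notin H & residue_unit p \notin K].
Proof.
move=> a_B aH w_B w2K; have w2_B : coprime (w * w) B by rewrite coprimeMl w_B.
have [chi char_chi [chiH chi_a]] :=
  dirichlet_character_exists Rdefinitions.R a_B aH.
have [psi char_psi [psiK psi_w2]] :=
  dirichlet_character_exists Rdefinitions.R w2_B w2K.
have [|||p [p_pr p_B chi_p psi_p]] :=
  @prime_outside_kernels _ B chi psi _ char_chi char_psi.
- exact: ltnW.
- by exists a.
- by exists w => //; case: char_psi => <-.
have pB : coprime p B by rewrite prime_coprime.
exists p; split=> //; first by apply: contra chi_p => /(chiH p pB) ->.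
by apply: contra psi_p => /(psiK p pB) ->.
Qed.

Lemma residue_unit_gen (P : pred nat) u : (forall p, P p -> coprime p B) ->
  u \in <<[set x | `[< exists2 p, P p & x = residue_unit p >]]>>%g ->
  exists2 s : seq nat, all P s & u = residue_unit (\prod_(p <- s) p).
Proof.
move=> P_B /gen_prodgP[n [c cP ->]].
elim: n c cP => [|n IH] c cP.
  by exists [::]; rewrite // big_ord0 big_nil residue_unit1.
have [s sP prodE] := IH (fun i => c (lift ord0 i)) (fun i => cP _).
have := cP ord0; rewrite inE => /asboolP[p pP c0E].
exists (p :: s); first by rewrite /= pP.
rewrite big_ord_recl prodE c0E big_cons residue_unitM ?(P_B p pP) //.
exact: coprime_prod_seq (sub_all P_B sP).
Qed.

(* Otherwise every prime would lie in K or in the proper subgroup H generated *)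
(* by the primes outside K.                                                   *)
Lemma prime_product_residue K w a :
  coprime w B -> residue_unit (w * w) \notin K -> coprime a B ->
  exists2 s : seq nat,
    all (fun p => [&& prime p, ~~ (p %| B)%N & residue_unit p \notin K]) s &
    (\prod_(p <- s) p = a %[mod B])%N.
Proof.
move=> w_B w2K a_B; set P := fun p => [&& _, _ & _].
have P_B p : P p -> coprime p B.
  by case/and3P=> p_pr p_B _; rewrite prime_coprime.
pose H := <<[set x | `[< exists2 p, P p & x = residue_unit p >]]>>%G.
have [/(residue_unit_gen P_B)[s sP aE]|aH] := boolP (residue_unit a \in H).
  exists s => //; apply/esym/residue_unit_eqP => //.
  exact: coprime_prod_seq (sub_all P_B sP).
have [p [p_pr p_B pH pK]] := prime_outside_subgroups a_B aH w_B w2K.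
case/negP: pH; apply: mem_gen; rewrite inE; apply/asboolP.
by exists p; rewrite // /P p_pr p_B.
Qed.

Lemma power_residue_group q e : (q %| B)%N -> exists K, forall n, coprime n B ->
  (residue_unit n \in K) = (n ^ e == 1 %[mod q])%N.
Proof.
move=> q_B.
pose K := [set u : {unit 'Z_B} | (val u : 'Z_B) ^ e == 1 %[mod q]]%N%SET.
have KE n : coprime n B -> (residue_unit n \in K) = (n ^ e == 1 %[mod q])%N.
  move=> n_B; rewrite inE val_residue_unit // val_Zp_nat //.
  by rewrite -(modnXm e q (n %% B)) modn_dvdm // modnXm.
have group_K : group_set K.
  apply/group_setP; split=> [|u v].
    by rewrite -residue_unit1 KE ?coprime1n // exp1n.
  have [m m_B ->] := residue_unitP u; have [n n_B ->] := residue_unitP v.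
  rewrite -residue_unitM // !KE ?coprimeMl ?m_B // expnMn => /eqP m_e /eqP n_e.
  by rewrite -modnMm m_e n_e modnMm.
by exists (Group group_K) => n; apply: KE.
Qed.

Lemma prime_product_power_residue q e w a :
  (q %| B)%N -> coprime w B -> ((w * w) ^ e != 1 %[mod q])%N -> coprime a B ->
  exists2 s : seq nat,
    all (fun p => [&& prime p, ~~ (p %| B) & (p ^ e != 1 %[mod q])])%N s &
    (\prod_(p <- s) p = a %[mod B])%N.
Proof.
move=> q_B w_B w2_e a_B; have [K KE] := power_residue_group e q_B.
have w2K : residue_unit (w * w) \notin K by rewrite KE ?coprimeMl ?w_B.
have [s sP sE] := prime_product_residue w_B w2K a_B; exists s => //.
apply: sub_all sP => p /and3P[p_pr p_B]; rewrite KE ?prime_coprime // => p_e.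
exact/and3P.
Qed.

End Residues.

Section PrimesInProgressions.
Implicit Types a b c e l : nat.

Lemma coprime_residue_shift a b l : prime l -> coprime a b ->
  exists2 a', coprime a' (b * l) & (a' = a %[mod b])%N.
Proof.
move=> l_pr a_b; have coprime_l m : coprime m l = ~~ (l %| m)%N.
  by rewrite coprime_sym prime_coprime.
case: (boolP (l %| a)%N) => l_a; last first.
  by exists a; rewrite // coprimeMr a_b coprime_l.
exists (a + b)%N; last by rewrite modnDr.
rewrite coprimeMr -coprime_modl modnDr coprime_modl a_b coprime_l /=.
rewrite dvdn_addr //; apply/negP => l_b.
by have := coprime_dvdl l_a a_b; rewrite prime_coprime // l_b.
Qed.

Lemma square_power_neq1 l b c e : prime l -> (0 < b)%N -> (0 < e)%N ->
  (9 ^ e < l ^ c.+1)%N ->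
  exists2 w, coprime w (b * l) & ((w * w) ^ e != 1 %[mod l ^ c.+1])%N.
Proof.
move=> l_pr b_gt0 e_gt0 lt_lc; pose w0 := if l == 2%N then 3%N else 2%N.
have coprime_lc : coprime (l ^ c.+1) b`_l^'.
  by rewrite coprimeXl // prime_coprime // -p'natE // part_pnat.
pose w := chinese (l ^ c.+1) b`_l^' w0 1.
have w_l : (w = w0 %[mod l ^ c.+1])%N by rewrite /w chinese_modl.
have w_l' : (w = 1 %[mod b`_l^'])%N by rewrite /w chinese_modr.
have coprime_w_l : coprime w l.
  rewrite -(coprime_pexpr _ _ (ltn0Sn c)) -coprime_modl w_l coprime_modl.
  rewrite coprimeXr // /w0; case: eqP => [->//|/eqP l_neq2].
  by rewrite prime_coprime // dvdn_prime2 // eq_sym.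
exists w.
  rewrite coprimeMr coprime_w_l andbT -(partnC l b_gt0) coprimeMr p_part.
  rewrite coprimeXr //=.
  by rewrite -coprime_modl w_l' coprime_modl coprime1n.
have -> : ((w * w) ^ e = (w0 * w0) ^ e %[mod l ^ c.+1])%N.
  by rewrite -modnXm -modnMm w_l modnMm modnXm.
have w0_gt1 : (1 < (w0 * w0) ^ e)%N.
  by rewrite -{1}(expn0 (w0 * w0)) ltn_exp2l // /w0; case: eqP.
have w0_lt : ((w0 * w0) ^ e < l ^ c.+1)%N.
  by apply: leq_ltn_trans lt_lc; rewrite leq_exp2r // /w0; case: eqP.
by rewrite !modn_small ?(ltn_trans w0_gt1) // neq_ltn w0_gt1 orbT.
Qed.

Lemma prime_product_modn a b l c e :
  prime l -> coprime a b -> (0 < b)%N -> (0 < e)%N -> (9 ^ e < l ^ c.+1)%N ->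
  exists2 s : seq nat,
    all (fun p => [&& prime p, p != l & (p ^ e != 1 %[mod l ^ c.+1])%N]) s &
    (\prod_(p <- s) p = a %[mod b])%N.
Proof.
move=> l_pr a_b b_gt0 e_gt0 lt_lc.
have [a' a'_bl a'E] := coprime_residue_shift l_pr a_b.
have [w w_bl w_e] := square_power_neq1 l_pr b_gt0 e_gt0 lt_lc.
pose B := (b * l ^ c.+1)%N; have lc_B : (l ^ c.+1 %| B)%N by rewrite dvdn_mull.
have l_B : (l %| B)%N by apply: dvdn_trans lc_B; rewrite dvdn_exp.
have B_gt1 : (1 < B)%N.
  apply: leq_trans (dvdn_leq _ l_B); rewrite ?prime_gt1 //.
  by rewrite muln_gt0 b_gt0 expn_gt0 prime_gt0.
have coprime_B m : coprime m (b * l) -> coprime m B.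
  by rewrite !coprimeMr => /andP[-> m_l]; rewrite coprimeXr.
have [s sP sE] := prime_product_power_residue B_gt1 lc_B
  (coprime_B _ w_bl) w_e (coprime_B _ a'_bl).
have b_B : (b %| B)%N by rewrite dvdn_mulr.
exists s; last by rewrite -a'E -(modn_dvdm _ b_B) sE modn_dvdm.
apply: sub_all sP => p /and3P[p_pr p_B p_e]; apply/and3P; split=> //.
by apply: contra p_B => /eqP ->.
Qed.

Lemma prime_product_progression (a b : int) l c e :
  prime l -> coprimez a b -> b != 0 -> (0 < e)%N -> (9 ^ e < l ^ c.+1)%N ->
  exists (s : seq nat) (x : int),
    all (fun p => [&& prime p, p != l & (p ^ e != 1 %[mod l ^ c.+1])%N]) s /\
    (\prod_(p <- s) p)%:Z = a + b * x.
Proof.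
move=> l_pr a_b b_neq0 e_gt0 lt_lc; pose a' := `|(a %% b)%Z|%N.
have a'E : a'%:Z = (a %% b)%Z by rewrite /a' gez0_abs // modz_ge0.
have a'_b : coprime a' `|b|.
  have : coprimez (a %% b)%Z b by rewrite /coprimez gcdz_modl.
  by rewrite coprimezE.
have b_gt0 : (0 < `|b|)%N by rewrite absz_gt0.
have [s sP sE] := prime_product_modn l_pr a'_b b_gt0 e_gt0 lt_lc.
set m := (\prod_(p <- s) p)%N in sE *.
have /dvdzP[x mE] : (b %| m%:Z - a)%Z.
  rewrite -eqz_mod_dvd -(modz_mod a) -a'E -(modz_abs m%:Z) -(modz_abs a'%:Z).
  by rewrite !modz_nat sE.
by exists s, x; split; rewrite // mulrC -mE addrC subrK.
Qed.

End PrimesInProgressions.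

(** * Orders modulo an integer *)

Section CongruentToOne.
Variable R : pzRingType.
Implicit Types (x y u : R) (k : int) (p l e C E N : nat).

Definition eq1mod k x : Prop := exists u, x = 1 + u *~ k.

Lemma eq1mod_unit k x : k * k = 1 -> eq1mod k x.
Proof.
by move=> k2_eq1; exists ((x - 1) *~ k); rewrite -mulrzA k2_eq1 addrC subrK.
Qed.

Lemma eq1modX k x e : eq1mod k x -> eq1mod k (x ^+ e).
Proof.
move=> [u ->]; elim: e => [|e [v IH]]; first by exists 0; rewrite mul0rz addr0.
exists (u + v + u * v *~ k); rewrite exprS IH mulrDl mul1r mulrDr mulr1.
by rewrite mulrzAl mulrzAr !mulrzDl -!addrA; congr (1 + _); rewrite addrCA.
Qed.

Lemma eq1modJ k x y y' : y' * y = 1 -> eq1mod k x -> eq1mod k (y' * (x * y)).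
Proof.
move=> y'y [u ->]; exists (y' * (u * y)).
by rewrite mulrDl mul1r mulrDr y'y mulrzAl mulrzAr.
Qed.

(* x^p - 1 = (x - 1) (1 + x + ... + x^(p-1)), and the second factor is        *)
(* divisible by p.                                                            *)
Lemma eq1mod_lift k p x :
  eq1mod k x -> eq1mod p%:Z x -> eq1mod (k * p%:Z) (x ^+ p).
Proof.
move=> [u xE] x_p.
have [v sumE] : exists v, \sum_(i < p) x ^+ i = v *~ p%:Z.
  suff /(_ p)[v sumE] :
      forall m, exists v, \sum_(i < m) x ^+ i = m%:R + v *~ p%:Z.
    by exists (1 + v); rewrite sumE mulrzDl.
  elim=> [|m [v sumE]]; first by exists 0; rewrite big_ord0 mul0rz addr0.
  have [w xmE] := eq1modX m x_p; exists (v + w).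
  by rewrite big_ord_recr /= sumE xmE mulrzDl -natr1 addrACA.
exists (u * v); apply/eqP; rewrite addrC -subr_eq subrX1 sumE {1}xE.
by rewrite addrAC subrr add0r mulrzAr mulrzAl mulrzA.
Qed.

Definition lpart_order_dvd l C k x : Prop :=
  exists2 e, ~~ (l %| e)%N & eq1mod k (x ^+ (l ^ C * e)).

Lemma lpart_order_dvd_logn l C k x E :
  prime l -> (0 < E)%N -> (logn l E <= C)%N ->
  eq1mod k (x ^+ E) -> lpart_order_dvd l C k x.
Proof.
move=> l_pr E_gt0 le_C x_E; exists (E`_l^')%N.
  by have := part_pnat (l^')%N E; rewrite p'natE.
have -> : (l ^ C * E`_l^' = E * l ^ (C - logn l E))%N.
  by rewrite -{2}(partnC l E_gt0) p_part mulnAC -expnD subnKC.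
by rewrite exprM; apply: eq1modX.
Qed.

Lemma lpart_order_dvdM l C k p x : prime l -> prime p -> p != l ->
  lpart_order_dvd l C p%:Z x -> lpart_order_dvd l C k x ->
  lpart_order_dvd l C (k * p%:Z) x.
Proof.
move=> l_pr p_pr p_neql [e l_e x_p] [f l_f x_k]; exists (e * f * p)%N.
  by rewrite !Euclid_dvdM // !negb_or l_e l_f (dvdn_prime2 l_pr p_pr) eq_sym.
rewrite mulnA exprM; apply: eq1mod_lift.
  by rewrite mulnCA mulnC exprM; apply: eq1modX.
by rewrite mulnA exprM; apply: eq1modX.
Qed.

Lemma lpart_order_dvd_prodX l C (s : seq nat) N x : prime l ->
  (forall p, p \in s -> [/\ prime p, p != l & lpart_order_dvd l C p%:Z x]) ->
  lpart_order_dvd l C ((\prod_(p <- s) p)%:Z ^+ N) x.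
Proof.
move=> l_pr sP; elim: N => [|N IH].
  by exists 1%N; [rewrite dvdn1; case: eqP l_pr => // -> | apply: eq1mod_unit].
rewrite exprSr; move: (_ ^+ N) IH => k x_k.
elim: s sP => [|p s IH] sP; first by rewrite big_nil mulr1.
have [p_pr p_neql x_p] := sP p (mem_head p s).
rewrite big_cons PoszM mulrCA mulrC; apply: lpart_order_dvdM => //.
by apply: IH => q q_s; apply: sP; rewrite inE q_s orbT.
Qed.

End CongruentToOne.

(** * Congruence subgroups *)

Section ModuloPrimeLinearGroup.
Implicit Types (n p l t : nat) (k : int).

Lemma eq1mod_mxP n k (A : 'M[int]_n) :
  eq1mod k A <-> forall i j, (A i j = (1%:M : 'M_n) i j %[mod k])%Z.
Proof.
have mulrzE (U : 'M[int]_n) i j : (U *~ k) i j = U i j * k.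
  by rewrite -scaler_int intz mxE mulrC.
split=> [[U ->] i j|eqA].
  by apply/eqP; rewrite eqz_mod_dvd mxE mulrzE addrAC subrr add0r dvdz_mull.
exists (\matrix_(i, j) ((A i j - (1%:M : 'M_n) i j) %/ k)%Z).
apply/matrixP => i j.
rewrite mxE mulrzE mxE divzK; first by rewrite addrC subrK.
by rewrite -eqz_mod_dvd; apply/eqP.
Qed.

Lemma eq1mod_card_GL n p (A : 'M[int]_n.+1) : prime p -> A \in unitmx ->
  eq1mod p%:Z (A ^+ #|'GL_n.+1(p)%g|).
Proof.
move=> p_pr A_unit; set E := #|_|; pose Ap := map_mx (intr : int -> 'F_p) A.
have Ap_unit : Ap \is a GRing.unit.
  rewrite -[_ \is a _]/(_ \in unitmx) unitmxE det_map_mx.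
  by apply: rmorph_unit; rewrite -unitmxE.
pose u : {'GL_n.+1['F_p]} := FinRing.unit 'M['F_p]_n.+1 Ap_unit.
have ApE : Ap ^+ E = 1.
  have := @expg_cardG _ [group of 'GL_n.+1['F_p]]%g u (finset.in_setT _).
  by move/(congr1 val); rewrite FinRing.val_unitX.
apply/eq1mod_mxP => i j; apply/eqP.
rewrite eqz_mod_dvd (dvdz_pcharf (pchar_Fp p_pr)) rmorphB subr_eq0 /=.
have := congr1 (fun M : 'M['F_p]_n.+1 => M i j) ApE.
by rewrite /Ap -rmorphXn mxE => ->; rewrite -[1]/(1%:M) !mxE rmorph_nat.
Qed.

Lemma logn_expnB1_le l p (i m : nat) t :
  prime l -> (1 < p ^ i)%N -> (i %| m)%N ->
  (p ^ m != 1 %[mod l ^ t.+1])%N -> (logn l (p ^ i - 1) <= t)%N.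
Proof.
move=> l_pr pi_gt1 /dvdnP[j ->]; apply: contraR; rewrite -ltnNge.
rewrite -pfactor_dvdn ?subn_gt0 // -eqn_mod_dvd 1?ltnW // => /eqP pi_eq1.
by rewrite mulnC expnM -modnXm pi_eq1 modnXm exp1n.
Qed.

Lemma logn_card_GL_le n p l t : (0 < n)%N -> prime l -> prime p -> p != l ->
  (p ^ n`! != 1 %[mod l ^ t.+1])%N -> (logn l #|'GL_n(p)%g| <= n * t)%N.
Proof.
move=> n_gt0 l_pr p_pr p_neql p_n; have p_gt0 := prime_gt0 p_pr.
have logn_prod m : (m <= n)%N -> (0 < \prod_(1 <= i < m.+1) (p ^ i - 1))%N &&
    (logn l (\prod_(1 <= i < m.+1) (p ^ i - 1)) <= m * t)%N.
  elim: m => [|m IH] lt_mn; first by rewrite big_geq // logn1.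
  have /andP[prod_gt0 logn_le] := IH (ltnW lt_mn).
  have pm_gt1 : (1 < p ^ m.+1)%N.
    by rewrite -{1}(expn0 p) ltn_exp2l // prime_gt1.
  rewrite big_nat_recr //= muln_gt0 prod_gt0 subn_gt0 pm_gt1 /=.
  rewrite lognM ?subn_gt0 // mulSn addnC leq_add //.
  by apply: logn_expnB1_le p_n; rewrite // dvdn_fact.
have /andP[prod_gt0 logn_le] := logn_prod n (leqnn n).
rewrite card_GL // card_Fp // lognM ?expn_gt0 ?p_gt0 //.
by rewrite lognX logn_prime // eq_sym (negPf p_neql) muln0.
Qed.

End ModuloPrimeLinearGroup.

(* The base 9 is the square of 3, which serves as w in square_power_neq1. *)
Definition exponent_bound n : nat := ((9 ^ n`!)`! ^ n)%N.

Lemma expn_trunc_log_dvd_bound l n : prime l ->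
  (l ^ (n * trunc_log l (9 ^ n`!)) %| exponent_bound n)%N.
Proof.
move=> l_pr; rewrite mulnC expnM /exponent_bound dvdn_exp2r // dvdn_fact //.
by rewrite expn_gt0 prime_gt0 // trunc_logP ?expn_gt0 // prime_gt1.
Qed.

Section Groups.
Local Open Scope group_scope.
Variable G : groupType.
Implicit Types (D H S : set G) (x y : G).

Lemma subgroupX H x k : subgroup H -> H x -> H (x ^+ k).
Proof.
move=> [oneH mulH _] Hx; elim: k => [|k IH]; first by rewrite expg0.
by rewrite expgS; apply: mulH.
Qed.

Lemma subgroup_generated S : subgroup (generated S).
Proof.
split=> [K [[]]//|x y Sx Sy K SK|x Sx K SK]; have [[_ mulK invK] _] := SK.
  by apply: mulK; [apply: Sx | apply: Sy].
by apply: invK; apply: Sx.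
Qed.

Lemma normal_generated D S : subgroup D -> (S `<=` D)%classic ->
  (forall x y, D x -> S y -> S (y ^ x)) -> normal_subgroup (generated S) D.
Proof.
move=> sD SD conjS; have sS := subgroup_generated S.
have [one_gen mul_gen inv_gen] := sS.
split=> // [|x y Dx]; first exact: smallest_sub.
apply: (@smallest_sub _ _ S [set z | generated S (z ^ x)])%classic
  => [|z Sz /=].
  split=> /= [|u v|u]; first by rewrite conj1g.
    by rewrite conjMg; apply: mul_gen.
  by rewrite conjVg; apply: inv_gen.
by apply: sub_gen_smallest; apply: conjS.
Qed.

Lemma ex_least_nat (P : nat -> Prop) : (exists n, P n) ->
  exists n, P n /\ forall m, P m -> (n <= m)%N.
Proof.
move=> exP; have exPb : exists n, `[< P n >].
  by case: exP => n /asboolP; exists n.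
case: (ex_minnP exPb) => n /asboolP Pn min_n; exists n; split=> // m /asboolP.
exact: min_n.
Qed.

Lemma subgroup_relative_order H x : subgroup H ->
  (exists2 k, (0 < k)%N & H (x ^+ k)) ->
  exists2 d, (0 < d)%N & forall k, H (x ^+ k) <-> (d %| k)%N.
Proof.
move=> sH [m m_gt0 Hm]; have [_ mulH invH] := sH.
have [|d [[d_gt0 Hd] min_d]] :=
  @ex_least_nat (fun k => (0 < k)%N /\ H (x ^+ k)).
  by exists m.
exists d => // k; split=> [Hk|/dvdnP[q ->]]; last first.
  by rewrite mulnC expgM; apply: subgroupX.
rewrite /dvdn; apply: contraT; rewrite -lt0n => mod_gt0.
suff /(conj mod_gt0)/min_d : H (x ^+ (k %% d)) by rewrite leqNgt ltn_mod d_gt0.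
have -> : x ^+ (k %% d) = (x ^+ d ^+ (k %/ d))^-1 * x ^+ k.
  by rewrite {3}(divn_eq k d) expgD mulnC expgM mulKg.
by apply: mulH => //; apply: invH; apply: subgroupX.
Qed.

Lemma subgroup_exponent_local H x (g : nat) : subgroup H ->
  (forall l, prime l -> exists C e : nat,
    [/\ ~~ (l %| e)%N, (l ^ C %| g)%N & H (x ^+ (l ^ C * e))]) ->
  H (x ^+ g).
Proof.
move=> sH local_exponent.
have ndvd_gt0 l e : ~~ (l %| e)%N -> (0 < e)%N by case: e; rewrite ?dvdn0.
have [|d d_gt0 dP] := @subgroup_relative_order H x sH.
  have [C [e [/ndvd_gt0 e_gt0 _ He]]] := local_exponent 2%N isT.
  by exists (2 ^ C * e)%N; rewrite // muln_gt0 expn_gt0.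
apply/dP/(dvdn_partP _ d_gt0) => l; rewrite mem_primes => /and3P[l_pr _ _].
have [C [e [l_e l_g /dP d_e]]] := local_exponent l l_pr.
rewrite p_part; apply: dvdn_trans l_g; apply: dvdn_exp2l.
have e_gt0 := ndvd_gt0 l e l_e.
have lC_gt0 : (0 < l ^ C)%N by rewrite expn_gt0 prime_gt0.
have coprime_l_e : coprime l e by rewrite prime_coprime.
have := dvdn_leq_log l _ d_e; rewrite muln_gt0 lC_gt0 e_gt0 => /(_ isT).
by rewrite lognM // pfactorK // (logn_coprime coprime_l_e) addn0.
Qed.

Lemma quotient_expE D H x e : subgroup D -> normal_subgroup H D -> D x ->
  quotient_exp H (setmul [set x]%classic H) e =
  [set y | H ((x ^+ e)^-1 * y)]%classic.
Proof.
move=> sD [[oneH mulH invH] _ conjH] Dx; rewrite /quotient_exp.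
elim: e => [|e IH] /=.
  by apply/seteqP; split=> y /=; rewrite expg0 invg1 mul1g.
rewrite IH; apply/seteqP; split=> y /=.
  move=> [_ [_ -> [h Hh <-]]] [z Hz <-].
  have -> : (x ^+ e.+1)^-1 * (x * h * z) = h ^ (x ^+ e) * ((x ^+ e)^-1 * z).
    by rewrite expgS invgM conjgE -!mulgA mulKg mulKVg.
  by apply: mulH => //; apply: conjH => //; apply: subgroupX.
move=> Hy; exists x; first by exists x => //; exists 1 => //; rewrite mulg1.
by exists (x^-1 * y); rewrite ?mulKVg //= mulgA -invgM -expgS.
Qed.

Lemma quotient_exponent_le D H (g : nat) : subgroup D -> normal_subgroup H D ->
  (0 < g)%N -> (forall x, D x -> H (x ^+ g)) ->
  exists e : nat, quotient_exponent D H e /\ (e <= g)%N.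
Proof.
move=> sD nH g_gt0 Hg; have [[_ mulH invH] _ _] := nH.
have kills_g : kills_quotient D H g.
  move=> _ [x Dx <-]; rewrite (quotient_expE _ sD nH Dx).
  have Hxg := Hg x Dx; apply/seteqP; split=> y /= Hy.
    by rewrite -[y](mulKVg (x ^+ g)); apply: mulH.
  by apply: mulH => //; apply: invH.
have [|e [[e_gt0 kills_e] min_e]] :=
  @ex_least_nat (fun k => (0 < k)%N /\ kills_quotient D H k); first by exists g.
by exists e; split; [split=> // d d_gt0 kills_d | ]; apply: min_e.
Qed.

End Groups.

Lemma lpart_order_progression n (a b : int) N l (A : 'M[int]_n.+1) :
  prime l -> coprimez a b -> A \in unitmx ->
  exists x : int, lpart_order_dvd l (n.+1 * trunc_log l (9 ^ (n.+1)`!))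
                    ((a + b * x) ^+ N) A.
Proof.
move=> l_pr a_b A_unit; set t := trunc_log _ _.
have [b0|b_neq0] := eqVneq b 0.
  exists 0, 1%N; first by rewrite dvdn1; case: eqP l_pr => // ->.
  rewrite mulr0 addr0; apply: eq1mod_unit; rewrite -exprMn.
  suff -> : a * a = 1 by rewrite expr1n.
  by move: a_b; rewrite b0 /coprimez gcdz0; nia.
have lt_pow9 : (9 ^ (n.+1)`! < l ^ t.+1)%N by rewrite trunc_log_ltn ?prime_gt1.
have [s [x [sP sE]]] :=
  prime_product_progression l_pr a_b b_neq0 (fact_gt0 n.+1) lt_pow9.
exists x; rewrite -sE; apply: lpart_order_dvd_prodX => // p.
move/(allP sP) => /and3P[p_pr p_neql p_n]; split=> //.
apply: lpart_order_dvd_logn (eq1mod_card_GL p_pr A_unit) => //.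
exact: logn_card_GL_le.
Qed.

Section ProgressionSubgroup.
Variable n : nat.
Implicit Types (A B : GLZ n.+1) (D : set (GLZ n.+1)) (k : int).

Lemma val_GLZX A m : val (A ^+ m)%g = val A ^+ m.
Proof. by elim: m => [//|m IH]; rewrite expgS exprS -IH. Qed.

Lemma congruence_subgroupP k A : congruence_subgroup k A <-> eq1mod k (val A).
Proof. by split=> /eq1mod_mxP. Qed.

Lemma congruence_subgroupJ k A B :
  congruence_subgroup k A -> congruence_subgroup k (A ^ B)%g.
Proof.
move=> /congruence_subgroupP A_k; apply/congruence_subgroupP; rewrite conjgE.
by apply: eq1modJ A_k; rewrite -[LHS]/(val (B^-1 * B)%g) mulVg.
Qed.

Lemma normal_progression_subgroup D (a b : int) N :
  subgroup D -> normal_subgroup (progression_subgroup D a b N) D.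
Proof.
move=> sD; have [_ mulD invD] := sD.
apply: normal_generated => // [A [x _ []] //|B A DB].
move=> [x _ [DA A_x]]; exists x => //; split; last exact: congruence_subgroupJ.
by rewrite conjgE; apply: (mulD) (mulD _ _ DA DB); apply: invD.
Qed.

Lemma progression_subgroup_exponent D (a b : int) N A :
  subgroup D -> coprimez a b -> D A ->
  progression_subgroup D a b N (A ^+ exponent_bound n.+1)%g.
Proof.
move=> sD a_b DA; apply: subgroup_exponent_local => [|l l_pr].
  exact: subgroup_generated.
have [x [e l_e A_x]] := lpart_order_progression N l_pr a_b (valP A).
exists (n.+1 * trunc_log l (9 ^ (n.+1)`!))%N, e.
split=> //; first exact: expn_trunc_log_dvd_bound.
apply: sub_gen_smallest; exists x => //; split; first exact: subgroupX.
by apply/congruence_subgroupP; rewrite val_GLZX.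
Qed.

End ProgressionSubgroup.

Theorem theorem1p2 (n : nat) (hn : (1 <= n)%N) :
  exists g : nat,
    forall (D : set (GLZ n)) (a b : int) (N : nat),
      subgroup D -> coprimez a b -> (0 < N)%N ->
      normal_subgroup (progression_subgroup D a b N) D /\
      exists e : nat,
        quotient_exponent D (progression_subgroup D a b N) e /\ (e <= g)%N.
Proof.
case: n hn => // n _; exists (exponent_bound n.+1) => D a b N sD a_b _.
have nD := normal_progression_subgroup a b N sD.
split=> //; apply: quotient_exponent_le => // [|A DA].
  by rewrite expn_gt0 fact_gt0.
exact: progression_subgroup_exponent.
Qed.
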